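(* Assume the $\bar p_\alpha$-measure condition with exponent $\kappa$: there are $\bar\alpha>0$ and a constant $C$ such that $$\operatorname{meas}(\{x\in\Omega_U:\alpha a(x)<-B^*\bar p_\alpha(x)<\alpha b(x)\})\le C\alpha^\kappa\quad\text{for all }0<\alpha<\bar\alpha .$$ Assume the regularity condition that $\|\partial_x B^*\bar p_\alpha\|_{L^\infty(\Omega_U)}\le C$ with a constant $C>0$ independent of $\alpha$, and let $a,b\in W^{1,\infty}(\Omega_U)$. Put $$C_{ab}:=\|\partial_x a\|_{L^\infty(\Omega_U)}+\|\partial_x b\|_{L^\infty(\Omega_U)} .$$ Then for each $p$ with $1\le p<\infty$ and all sufficiently small $\alpha>0$ one has $$\|\partial_x\bar u_\alpha\|_{L^p(\Omega_U)}\le C\max(C_{ab},\alpha^{\kappa/p-1})$$ with a constant $C>0$ independent of $\alpha$.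
   Context: Setting. $\Omega_U\subset\mathbb R^n$, $n\ge1$, is a bounded measurable domain (open, so that weak derivatives make sense), $U:=L^2(\Omega_U)$ (real-valued), $H$ is an arbitrary (real) Hilbert space, $z\in H$ is fixed, and $T:U\to H$ is linear and continuous, written as $T=SB$ with continuous linear operators $B:U\to R$, $S:R\to H$ for some function space $R$ (always possible, e.g. $B=\mathrm{Id}$, $S=T$). Adjoints are denoted by $^*$, and $U$, $H$ are identified with their duals. Bounds $a,b\in L^\infty(\Omega_U)$ with $a\le b$ are given and $U_{\rm ad}:=\{u\in U: a(x)\le u(x)\le b(x)\text{ for almost all }x\in\Omega_U\}$. $\partial_x$ denotes the weak differential operator (weak gradient) on $\Omega_U$; the regularity condition includes that $B^*\bar p_\alpha$ is weakly differentiable with essentially bounded derivative. For $\alpha>0$, problem $(\mathbb P_\alpha)$ is $\min_{u\in U_{\rm ad}}\ \frac12\|Tu-z\|_H^2+\frac\alpha2\|u\|_U^2$. It has a unique solution $\bar u_\alpha$. Put $\bar y_\alpha:=T\bar u_\alpha$ and $\bar p_\alpha:=S^*(\bar y_\alpha-z)$, so that $B^*\bar p_\alpha=T^*(T\bar u_\alpha-z)\in U$. In the $\bar p_\alpha$-measure condition, $\kappa>0$, with the convention that $\kappa:=\infty$ if the measure is zero for all $0<\alpha<\bar\alpha$; in that case the conclusion is read as holding with $\kappa$ replaced by any finite positive number (with constant depending on it). *)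

(* Defs.v *)
From HB Require Import structures.
From mathcomp Require Import all_boot all_order all_algebra.
From mathcomp Require Import all_classical all_reals all_analysis.

Set Implicit Arguments.
Unset Strict Implicit.
Unset Printing Implicit Defensive.

Import Order.TTheory GRing.Theory Num.Theory.
Import numFieldNormedType.Exports.

Local Open Scope classical_set_scope.
Local Open Scope ring_scope.

(* The product sigma-algebra on R^n, i.e. the one generated by the coordinate
   maps; it is the Borel sigma-algebra. *)
Section measurable_rV.
Context (R : realType) (n : nat).

Let coord (i : 'I_n) (x : 'rV[R]_n) : R := x 0 i.

Let rV_set0 : g_sigma_preimage coord set0.
Proof. exact: sigma_algebra0. Qed.

Let rV_setC A : g_sigma_preimage coord A -> g_sigma_preimage coord (~` A).
Proof. exact: sigma_algebraC. Qed.

Let rV_bigcup (F : (set 'rV[R]_n)^nat) :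
  (forall i, g_sigma_preimage coord (F i)) ->
  g_sigma_preimage coord (\bigcup_i (F i)).
Proof. exact: sigma_algebra_bigcup. Qed.

HB.instance Definition _ :=
  @isMeasurable.Build (measure_tuple_display default_measure_display)
    'rV[R]_n (g_sigma_preimage coord) rV_set0 rV_setC rV_bigcup.

End measurable_rV.

Lemma measurable_coord (R : realType) n (i : 'I_n) :
  measurable_fun [set: 'rV[R]_n] (fun x : 'rV[R]_n => x 0 i : R).
Proof.
move=> _ Y mY; rewrite setTI; apply: sub_sigma_algebra => /=.
rewrite -bigcup_seq/=; exists i => /=; first by rewrite mem_index_enum.
by exists Y => //; rewrite setTI.
Qed.

Lemma measurable_fun_rV (R : realType) n d (T : measurableType d)
    (f : T -> 'rV[R]_n) :
  (forall i, measurable_fun setT (fun t => f t 0 i : R)) ->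
  measurable_fun setT f.
Proof.
move=> mf _ A mA; rewrite setTI.
suff : g_sigma_preimage (fun i (t : T) => f t 0 i : R) `<=` measurable.
  apply; rewrite (_ : (fun i t => _) =
    (fun i => (fun x : 'rV[R]_n => x 0 i : R) \o f)) //.
  by rewrite g_sigma_preimage_comp; exists A => //; rewrite setTI.
apply: smallest_sub; first exact: sigma_algebra_measurable.
case: n => [|n] in f A mA mf *; first by rewrite big_ord0.
rewrite -bigcup_mkord_ord; apply: bigcup_sub => i Ii.
by move=> B [C mC <-]; exact: mf.
Qed.


Definition cons_rV (R : realType) n (p : R * 'rV[R]_n) : 'rV[R]_n.+1 :=
  \row_i (if unlift ord0 i is Some j then p.2 0 j else p.1).

Lemma cons_rV0 (R : realType) n (p : R * 'rV[R]_n) : cons_rV p 0 ord0 = p.1.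
Proof. by rewrite mxE unlift_none. Qed.

Lemma cons_rVS (R : realType) n (p : R * 'rV[R]_n) (i : 'I_n) :
  cons_rV p 0 (lift ord0 i) = p.2 0 i.
Proof. by rewrite mxE liftK. Qed.

Lemma measurable_cons_rV (R : realType) n :
  measurable_fun [set: R * 'rV[R]_n] (@cons_rV R n).
Proof.
apply: measurable_fun_rV => i.
have [j ->|->] := unliftP ord0 i.
- rewrite (_ : (fun _ => _) = (fun x : 'rV[R]_n => x 0 j : R) \o snd).
    exact: (measurableT_comp (measurable_coord j)).
  by apply/funext => p /=; exact: cons_rVS.
- rewrite (_ : (fun _ => _) = fst) //.
  by apply/funext => p /=; exact: cons_rV0.
Qed.

Definition uncons_rV (R : realType) n (x : 'rV[R]_n.+1) : R * 'rV[R]_n :=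
  (x 0 ord0, \row_i x 0 (lift ord0 i)).

Lemma cons_rVK (R : realType) n : cancel (@cons_rV R n) (@uncons_rV R n).
Proof.
move=> [t x]; rewrite /uncons_rV cons_rV0; congr pair.
by apply/rowP => i; rewrite mxE cons_rVS.
Qed.

Lemma measurable_uncons_rV (R : realType) n :
  measurable_fun [set: 'rV[R]_n.+1] (@uncons_rV R n).
Proof.
apply: measurable_fun_pair => /=; first exact: measurable_coord.
apply: measurable_fun_rV => i.
rewrite (_ : (fun _ => _) = fun x : 'rV[R]_n.+1 => x 0 (lift ord0 i) : R).
  exact: measurable_coord.
by apply/funext => x; rewrite mxE.
Qed.

Section cons_measure.
Context (R : realType) (n : nat).
Variable mu : {sigma_finite_measure set 'rV[R]_n -> \bar R}.

Definition cons_measure : set 'rV[R]_n.+1 -> \bar R :=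
  pushforward (@lebesgue_measure R \x mu)%E (@cons_rV R n).

HB.instance Definition _ := Measure.copy cons_measure
  (measure_function_pushforward__canonical__measure_function_Measure
     (@lebesgue_measure R \x mu)%E (@measurable_cons_rV R n)).

Let cons_measure_sigma_finite : sigma_finite setT cons_measure.
Proof.
have /sigma_finiteP[F [TF ndF Foo]] := sigma_finiteT (@lebesgue_measure R).
have /sigma_finiteP[G [TG ndG Goo]] := sigma_finiteT mu.
exists (fun k => @uncons_rV R n @^-1` (F k `*` G k)).
  apply/seteqP; split => // x _.
  have [i _ Fi] : (\bigcup_i F i) (x 0 ord0) by rewrite -TF.
  have [j _ Gj] : (\bigcup_i G i) (uncons_rV x).2 by rewrite -TG.
  exists (maxn i j) => //; split => /=.
    by move: Fi; exact/subsetPset/ndF/leq_maxl.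
  by move: Gj; exact/subsetPset/ndG/leq_maxr.
move=> k; have [mF Fk] := Foo k; have [mG Gk] := Goo k.
split; first by rewrite -[X in measurable X]setTI;
  apply: measurable_uncons_rV => //; exact: measurableX.
rewrite /cons_measure /pushforward -comp_preimage.
rewrite (_ : _ \o _ = id) ?preimage_id; last first.
  by apply/funext => p; exact: cons_rVK.
by rewrite product_measure1E// lte_mul_pinfty// ge0_fin_numE.
Qed.

HB.instance Definition _ := Measure_isSigmaFinite.Build _ _ _ cons_measure
  cons_measure_sigma_finite.

End cons_measure.

(* Lebesgue measure on R^n: lebesgue_rV 0 is the unit mass of the point R^0, and
   lebesgue_rV n.+1 is lebesgue_measure \x lebesgue_rV n, transported along
   R * R^n -> R^n.+1. *)
Fixpoint lebesgue_rV (R : realType) (n : nat) :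
    {sigma_finite_measure set 'rV[R]_n -> \bar R} :=
  match n with
  | 0 => @dirac _ 'rV[R]_0 0 R
  | m.+1 => cons_measure (lebesgue_rV R m)
  end.

Lemma lebesgue_rV_box (R : realType) n (a b : 'rV[R]_n) :
  (forall i, a 0 i <= b 0 i) ->
  lebesgue_rV R n [set x | forall i, a 0 i < x 0 i <= b 0 i] =
    (\prod_(i < n) (b 0 i - a 0 i))%:E.
Proof.
elim: n a b => [|n IH] a b ab /=.
  rewrite big_ord0 diracE mem_set// => -[] //.
rewrite big_ord_recl /cons_measure /pushforward.
set B := (X in _ @^-1` X).
pose a' := (uncons_rV a).2; pose b' := (uncons_rV b).2.
have -> : @cons_rV R n @^-1` B = `]a 0 ord0, b 0 ord0]%classic `*`
    [set x : 'rV[R]_n | forall i, a' 0 i < x 0 i <= b' 0 i].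
  apply/seteqP; split => -[t x].
  - move=> h; split => /=.
      by have := h ord0; rewrite cons_rV0 in_itv.
    by move=> i; have := h (lift ord0 i); rewrite cons_rVS !mxE.
  - move=> [/= h1 h2] i; have [j ->|->] := unliftP ord0 i.
      by rewrite cons_rVS; have := h2 j; rewrite !mxE.
    by rewrite cons_rV0; move: h1; rewrite in_itv.
rewrite product_measure1E//; last first.
  rewrite (_ : [set x | _] = \bigcap_(i in [set: 'I_n])
    ((fun x : 'rV[R]_n => x 0 i : R) @^-1` `]a' 0 i, b' 0 i]%classic)).
    apply: fin_bigcap_measurable => // i _.
    by rewrite -[X in measurable X]setTI; exact: measurable_coord.
  apply/seteqP; split => x h i; first by move=> _; have := h i; rewrite /= in_itv.
  by have := h i I; rewrite /= in_itv.
rewrite IH; last by move=> i; rewrite !mxE.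
rewrite [X in (X * _)%E]lebesgue_measure_itv/= lte_fin.
under eq_bigr do rewrite !mxE.
rewrite EFinM; case: ltP => [_|ba]; first by rewrite EFinB.
have -> : a 0 ord0 = b 0 ord0 by apply/le_anti; rewrite ab.
by rewrite subrr !mul0e.
Qed.

Section weak_gradient.
Context (R : realType) (n : nat).
Implicit Types (D : set 'rV[R]_n) (u phi : 'rV[R]_n -> R)
  (g : 'rV[R]_n -> 'rV[R]_n).

Definition euclidean_norm (v : 'rV[R]_n) : R :=
  Num.sqrt (\sum_(i < n) v 0 i ^+ 2).

Definition partial (i : 'I_n) phi : 'rV[R]_n -> R :=
  fun x => 'D_(delta_mx 0 i) phi x.

Fixpoint classC (k : nat) phi : Prop :=
  match k with
  | 0 => continuous phi
  | k'.+1 => continuous phi /\ forall i : 'I_n,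
      (forall x, derivable phi x (delta_mx 0 i)) /\ classC k' (partial i phi)
  end.

(* C_c^oo(D) *)
Definition test_function D phi : Prop :=
  let supp := closure [set x | phi x != 0] in
  [/\ forall k, classC k phi, compact supp & supp `<=` D].

Definition locally_integrable_on D u : Prop :=
  forall K, compact K -> K `<=` D -> (lebesgue_rV R n).-integrable K (EFin \o u).

(* Functions on D are represented by measurable functions on R^n, whose values
   outside D are irrelevant. *)
Definition is_weak_gradient D u g : Prop :=
  [/\ locally_integrable_on D u,
      forall i, measurable_fun setT (fun x => g x 0 i),
      forall i, locally_integrable_on D (fun x => g x 0 i) &
      forall phi i, test_function D phi ->
        \int[lebesgue_rV R n]_(x in D) (u x * partial i phi x) =
        - \int[lebesgue_rV R n]_(x in D) (g x 0 i * phi x)].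

Definition weakly_differentiable D u : Prop := exists g, is_weak_gradient D u g.

(* The weak gradient, which is unique up to null sets of D; the default value 0
   is taken when u is not weakly differentiable on D. *)
Definition weak_gradient D u : 'rV[R]_n -> 'rV[R]_n :=
  xget (cst 0) [set g | is_weak_gradient D u g].

End weak_gradient.

Section Lebesgue_spaces.
Context (R : realType) (n : nat) (D : set 'rV[R]_n) (mD : measurable D).

Definition lebesgue_on : {measure set 'rV[R]_n -> \bar R} :=
  mrestr (lebesgue_rV R n) mD.

(* The norm of the weak gradient of u in L^p(D). *)
Definition weak_gradient_norm (p : \bar R) (u : 'rV[R]_n -> R) : \bar R :=
  'N[lebesgue_on]_p[(fun x => (euclidean_norm (weak_gradient D u x))%:E)]%E.

Definition W1infty (u : 'rV[R]_n -> R) : Prop :=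
  [/\ u \in Lfun lebesgue_on +oo%E, weakly_differentiable D u &
      (weak_gradient_norm +oo u < +oo)%E].

(* L^2(D), as the space of square-integrable functions; its elements matter
   only up to equality almost everywhere, with respect to which the norm and
   the inner product below are compatible. *)
Definition L2 := LfunType lebesgue_on (lee1n 2).

Definition L2_norm (u : L2) : R := fine 'N[lebesgue_on]_2[EFin \o u]%E.

Definition L2_dot (u v : L2) : R := \int[lebesgue_on]_x (u x * v x).

Definition L2_continuous (V : normedModType R) (f : L2 -> V) : Prop :=
  forall u (e : R), 0 < e -> exists2 d : R, 0 < d &
    forall v : L2, L2_norm (v - u) < d -> `|f v - f u| < e.

End Lebesgue_spaces.

Arguments L2_norm {R n D mD} u.
Arguments L2_dot {R n D mD} u v.
Arguments L2_continuous {R n D mD V} f.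

(* A real Hilbert space is a complete normed space H with an inner product dot
   that induces the norm of H. *)
Definition induces_norm (R : realType) (H : completeNormedModType R)
    (dot : {dot H for idfun}) : Prop :=
  forall h : H, dot h h = `|h| ^+ 2.

(* The adjoint S^* : H -> Y^* of S : Y -> H, where H is identified with its
   dual. *)
Definition adjoint (R : realType) (H : completeNormedModType R)
    (dot : {dot H for idfun}) (Y : normedModType R) (S : Y -> H) (h : H) :
    Y -> R :=
  fun y => dot h (S y).

(* Bs is the adjoint B^* : Y^* -> L^2(D) of B : L^2(D) -> Y, where L^2(D) is
   identified with its dual; the values of Bs outside Y^* are irrelevant. *)
Definition is_L2_adjoint (R : realType) (n : nat) (D : set 'rV[R]_n)
    (mD : measurable D) (Y : normedModType R) (B : L2 mD -> Y)
    (Bs : (Y -> R) -> L2 mD) : Prop :=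
  forall f : Y -> R, scalar f -> continuous f ->
    forall u : L2 mD, L2_dot (Bs f) u = f (B u).

Section control_problem.
Context (R : realType) (n : nat) (D : set 'rV[R]_n) (mD : measurable D).
Context (H : completeNormedModType R) (T : L2 mD -> H) (z : H).
Context (a b : 'rV[R]_n -> R).

Definition admissible : set (L2 mD) :=
  [set u | {ae lebesgue_on mD, forall x, a x <= u x <= b x}].

Definition objective (alpha : R) (u : L2 mD) : R :=
  2^-1 * `|T u - z| ^+ 2 + alpha / 2 * L2_norm u ^+ 2.

Definition solves_P (alpha : R) (u : L2 mD) : Prop :=
  admissible u /\
  forall v, admissible v -> objective alpha u <= objective alpha v.

End control_problem.

(* The measure condition for the family q alpha = B^* p_alpha; kappa = +oo
   encodes that the measure vanishes for all small alpha. *)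
Definition measure_condition (R : realType) (n : nat) (D : set 'rV[R]_n)
    (a b : 'rV[R]_n -> R) (q : R -> 'rV[R]_n -> R) (kappa : \bar R) : Prop :=
  let m alpha := lebesgue_rV R n
    [set x | D x /\ alpha * a x < - q alpha x < alpha * b x] in
  match kappa with
  | k%:E => 0 < k /\ exists (alphabar C : R), 0 < alphabar /\
      forall alpha, 0 < alpha < alphabar -> (m alpha <= (C * alpha `^ k)%:E)%E
  | +oo%E => exists2 alphabar : R, 0 < alphabar &
      forall alpha, 0 < alpha < alphabar -> m alpha = 0%E
  | -oo%E => False
  end.

(* Main.v *)
(* The variational inequality for problem (P_alpha) says that the minimizer is the
   pointwise projection of - q / alpha onto [a, b], with q = B^* p_alpha. Hence
   its weak gradient is that of a or of b, except on the set where
   alpha a < - q < alpha b, where it is - grad q / alpha; the L^oo bound on grad q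
   and the measure condition bound the L^p norm of the latter part by a multiple
   of alpha^(k/p - 1).

   The chain rule for the projection reduces to the one for the positive part of
   a function u with a bounded weak derivative g in direction e_i. Testing with
   smooth product bumps gives u(x + h e_i) - u(x) = int_0^h g(x + t e_i) dt for
   almost every x. By one-dimensional Lebesgue differentiation the difference
   quotients then converge almost everywhere to g, and they are bounded, so that
   one can pass to the limit in the difference quotients of a C^(1,1)
   regularization of the positive part of u. *)

(* Values outside the domain [D] are irrelevant, so translating a function on [D] makes no sense as
   it stands. Before any translation, [u] and its derivative are cut off to a compact neighbourhood
   of the support of the test function; there they become integrable over the whole space, where
   translation invariance and Fubini apply. [weak_gradient] returns an arbitrarily chosen gradient.
   Pointwise statements about it therefore rest on uniqueness almost everywhere, which needs the
   fundamental lemma, tested here with bumps on boxes only. The projection is built from two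
   positive parts: min(b, v) = b - (b - v)^+ and max(a, w) = a + (w - a)^+. The derivative found for
   u^+ is 0 where u = 0, so points at which two branches meet need no separate treatment. The final
   constant is (|D| + C0^p K)^(1/p) + 1, with C0 the bound on grad q and K the constant of the
   measure condition; the summand 1 makes it positive. For [kappa = +oo] one may take K = 0 with any
   exponent k. *)
Require Import Defs.
From HB Require Import structures.
From mathcomp Require Import all_boot all_order all_algebra.
From mathcomp Require Import all_classical all_reals all_analysis.
From mathcomp Require Import measurable_realfun ess_sup_inf lra ring.

Import Order.TTheory GRing.Theory Num.Theory.
Import numFieldNormedType.Exports.

Set Implicit Arguments.
Unset Strict Implicit.
Unset Printing Implicit Defensive.

Local Open Scope classical_set_scope.
Local Open Scope ring_scope.

(** * Lebesgue measure on R^n *)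

Section boxes.
Context (R : realType) (n : nat).
Implicit Types (a b x : 'rV[R]_n) (A K O : set 'rV[R]_n).
Local Notation mu := (lebesgue_rV R n).

Lemma rV_norm_ltP (x : 'rV[R]_n) e : 0 < e ->
  (`|x| < e) <-> (forall i, `|x 0 i| < e).
Proof.
move=> e0; have := @mx_norm_ball R 1 n; rewrite predeq3E => /(_ 0 e x).
rewrite /ball_/= sub0r normrN => <-; split.
  by move=> [_ h] i; have := h 0 i; rewrite /ball/= mxE sub0r normrN.
move=> h; split => // i j; rewrite ord1 /ball/= mxE sub0r normrN.
exact: h.
Qed.

Lemma rV_norm_leP (x : 'rV[R]_n) e : 0 <= e ->
  (`|x| <= e) <-> (forall i, `|x 0 i| <= e).
Proof.
move=> e0; split => [xe i|h].
  apply/unstable.ler_gtP; move=> y ey; have y0 : 0 < y := le_lt_trans e0 ey.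
  by have /(rV_norm_ltP _ y0)/(_ i)/ltW : `|x| < y := le_lt_trans xe ey.
apply/unstable.ler_gtP; move=> y ey; have y0 : 0 < y := le_lt_trans e0 ey.
by apply/ltW/rV_norm_ltP => // i; exact: le_lt_trans (h i) ey.
Qed.

Definition hbox a b : set 'rV[R]_n := [set x | forall i, a 0 i < x 0 i <= b 0 i].
Definition cbox a b : set 'rV[R]_n := [set x | forall i, a 0 i <= x 0 i <= b 0 i].

Lemma measurable_forall_coord (P : 'I_n -> set R) :
  (forall i, measurable (P i)) ->
  measurable [set x : 'rV[R]_n | forall i, P i (x 0 i)].
Proof.
move=> mP.
rewrite (_ : [set x | _] = \bigcap_(i in [set: 'I_n])
    ((fun x : 'rV[R]_n => x 0 i : R) @^-1` P i)); last first.
  by apply/seteqP; split => x h i; [move=> _; exact: h|exact: (h i I)].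
apply: fin_bigcap_measurable => // i _.
by rewrite -[X in measurable X]setTI; exact: measurable_coord.
Qed.

Lemma measurable_hbox a b : measurable (hbox a b).
Proof.
rewrite (_ : hbox a b = [set x | forall i, `]a 0 i, b 0 i]%classic (x 0 i)]).
  by apply: (measurable_forall_coord (P := fun i => `]a 0 i, b 0 i]%classic)).
by apply/seteqP; split => x h i; have := h i; rewrite /= in_itv.
Qed.

Lemma measurable_cbox a b : measurable (cbox a b).
Proof.
rewrite (_ : cbox a b = [set x | forall i, `[a 0 i, b 0 i]%classic (x 0 i)]).
  by apply: (measurable_forall_coord (P := fun i => `[a 0 i, b 0 i]%classic)).
by apply/seteqP; split => x h i; have := h i; rewrite /= in_itv.
Qed.

Lemma cbox_compact a b : compact (cbox a b).
Proof.
rewrite (_ : cbox a b = [set x | forall i, `[a 0 i, b 0 i]%classic (x ord0 i)]).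
  apply: (rV_compact (A := fun i => `[a 0 i, b 0 i]%classic)) => i.
  exact: segment_compact.
by apply/seteqP; split => x h i; have := h i; rewrite /= in_itv.
Qed.

(** The pi-system on which measures and integrals are compared: half-open boxes have finite measure,
    are stable under intersection, exhaust the space and generate the sigma-algebra. *)
Definition hboxes : set_system 'rV[R]_n := [set A | exists a b, A = hbox a b].

Lemma hbox_bigcup : \bigcup_k hbox (const_mx (- k%:R)) (const_mx k%:R) = setT.
Proof.
apply/seteqP; split => // x _.
exists (Num.bound (`|x| + 1)) => // i; rewrite !mxE.
have : `|x 0 i| < (Num.bound (`|x| + 1))%:R.
  apply: (@lt_trans _ _ (`|x| + 1)); last by rewrite archi_boundP// addr_ge0.
  by apply: (@le_lt_trans _ _ `|x|); [exact: (rV_norm_leP x (normr_ge0 x)).1|rewrite ltrDl].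
by rewrite ltr_norml => /andP[-> /ltW ->].
Qed.

Lemma hboxI a b a' b' : hbox a b `&` hbox a' b' =
  hbox (\row_i Num.max (a 0 i) (a' 0 i)) (\row_i Num.min (b 0 i) (b' 0 i)).
Proof.
apply/seteqP; split => x.
  move=> [h h'] i; have /andP[h1 h2] := h i; have /andP[h3 h4] := h' i.
  by rewrite !mxE gt_max le_min h1 h2 h3 h4.
by move=> h; split => i; have := h i; rewrite !mxE gt_max le_min;
  move=> /andP[/andP[h1 h2] /andP[h3 h4]]; apply/andP.
Qed.

Lemma hboxes_setI : setI_closed hboxes.
Proof.
move=> _ _ [a [b ->]] [a' [b' ->]]; rewrite hboxI.
by eexists; eexists.
Qed.

(** For the inclusion from left to right it suffices that coordinates are measurable for the
    sigma-algebra generated by boxes: the slab where coordinate [i] lies in []p, q]] is the union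
    over k of the boxes with side []p, q]] in direction [i] and []-k, k]] in the others. *)
Lemma measurable_hboxesE : @measurable _ 'rV[R]_n = <<s hboxes >>.
Proof.
apply/seteqP; split; last first.
  apply: smallest_sub; first exact: sigma_algebra_measurable.
  by move=> _ [a [b ->]]; exact: measurable_hbox.
pose T' := g_sigma_algebraType hboxes.
have mc (i : 'I_n) : @measurable_fun _ _ T' R setT (fun x : 'rV[R]_n => x 0 i).
  apply: (measurability _ (erefl (@measurable _ (measurableTypeR R)))).
  move=> _ [_ [[p q] _ <-] <-]; rewrite setTI/=.
  rewrite (_ : _ @^-1` _ = \bigcup_k hbox
      (\row_j if j == i then p else - k%:R) (\row_j if j == i then q else k%:R)).
    apply: bigcupT_measurable => k; apply: sub_sigma_algebra.
    by eexists; eexists.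
  apply/seteqP; split => x /=; last first.
    by move=> [k _ /(_ i)]; rewrite !mxE eqxx in_itv.
  rewrite in_itv/= => pq; have : setT x by [].
  rewrite -hbox_bigcup => -[k _ kx]; exists k => // j.
  by have := kx j; rewrite !mxE; case: eqP => [->//|].
have : @measurable_fun _ _ T' 'rV[R]_n setT id by exact: measurable_fun_rV.
by move=> h A mA; have := h measurableT _ mA; rewrite setTI preimage_id.
Qed.

Lemma hbox_fin a b : (mu (hbox a b) < +oo)%E.
Proof.
have [ab|] := pselect (forall i, a 0 i <= b 0 i).
  by rewrite lebesgue_rV_box// ltry.
move=> /existsNP[i /negP]; rewrite -ltNge => ba.
rewrite (_ : hbox a b = set0) ?measure0//.
apply/seteqP; split => // x /(_ i) /andP[ax xb].
by have := lt_le_trans ax xb; rewrite ltNge (ltW ba).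
Qed.

Lemma cbox_fin a b : (mu (cbox a b) < +oo)%E.
Proof.
apply: le_lt_trans (hbox_fin (a - const_mx 1) b).
apply: le_measure; rewrite ?inE; [exact: measurable_cbox|exact: measurable_hbox|].
move=> x h i; have /andP[ax ->] := h i; rewrite andbT !mxE.
by rewrite (lt_le_trans _ ax)// ltrBlDr ltrDl.
Qed.

Definition shift_rV (v x : 'rV[R]_n) : 'rV[R]_n := x + v.

Lemma measurable_shift_rV v : measurable_fun setT (shift_rV v).
Proof.
apply: measurable_fun_rV => i; rewrite /shift_rV.
under eq_fun do rewrite mxE.
by apply: measurable_funD => //; exact: measurable_coord.
Qed.

(** The image measure under the translation agrees with [mu] on half-open boxes, hence everywhere by
    uniqueness on a generating pi-system. *)
Lemma lebesgue_rV_shift v A : measurable A -> mu (shift_rV v @^-1` A) = mu A.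
Proof.
move=> mA; have ms := measurable_shift_rV v.
pose nu := measure_function_pushforward__canonical__measure_function_Measure
  mu ms.
have := @measure_unique _ R _ hboxes
  (fun k => hbox (const_mx (- k%:R)) (const_mx k%:R)) measurable_hboxesE
  hboxes_setI _ hbox_bigcup mu nu.
move=> /(_ _ _ _ A mA) H; apply/esym; apply: H.
- by move=> k; eexists; eexists.
- move=> _ [a [b ->]]; rewrite /nu/= /pushforward.
  have -> : shift_rV v @^-1` hbox a b = hbox (a - v) (b - v).
    apply/seteqP; split => x h i; have := h i; rewrite !mxE;
    by rewrite ltrBlDr lerBrDr.
  have [ab|] := pselect (forall i, a 0 i <= b 0 i).
    rewrite !lebesgue_rV_box//; last by move=> i; rewrite !mxE lerB.
    by congr (_%:E); apply: eq_bigr => i _; rewrite !mxE; ring.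
  move=> /existsNP[i /negP]; rewrite -ltNge => ba.
  rewrite (_ : hbox a b = set0); last first.
    apply/seteqP; split => // x /(_ i) /andP[ax xb].
    by have := lt_le_trans ax xb; rewrite ltNge (ltW ba).
  rewrite (_ : hbox _ _ = set0) ?measure0//.
  apply/seteqP; split => // x /(_ i) /andP[ax xb].
  by have := lt_le_trans ax xb; rewrite !mxE ltNge lerB// ltW.
- by move=> k; exact: hbox_fin.
Qed.

(* Cubes around rational points form a countable base. *)
Definition rcube (p : 'rV[rat]_n * nat) (s : R) : set 'rV[R]_n :=
  hbox (\row_i (ratr (p.1 0 i) - s * p.2.+1%:R^-1))
       (\row_i (ratr (p.1 0 i) + s * p.2.+1%:R^-1)).

Definition rccube (p : 'rV[rat]_n * nat) (s : R) : set 'rV[R]_n :=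
  cbox (\row_i (ratr (p.1 0 i) - s * p.2.+1%:R^-1))
       (\row_i (ratr (p.1 0 i) + s * p.2.+1%:R^-1)).

(** The cubes are selected by their closed doubles [rccube p 2], which leaves a margin around
    [rcube p 1] inside [O]; the fundamental lemma spends this margin on its bumps. *)
Lemma open_rcube O : open O ->
  O = \bigcup_(p in [set p | rccube p 2 `<=` O]) rcube p 1.
Proof.
move=> oO; apply/seteqP; split => x; last first.
  move=> [p /= pO]; move=> px; apply: pO => i.
  have := px i; rewrite !mxE => /andP[h1 h2].
  have : 0 < p.2.+1%:R^-1 :> R by rewrite invr_gt0.
  move: h1 h2; set r : R := _^-1; lra.
move=> Ox; have := oO _ Ox; rewrite -nbhs_ballE => -[e e0 eO].
(* The centre is within 1/(k+1) of [x] and the doubled cube has half-side 2/(k+1), so its points are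
   within 3/(k+1) < e of [x]. *)
pose k := Num.bound (e^-1 * 4).
have ke : k.+1%:R^-1 < e / 4 :> R.
  rewrite invf_plt ?posrE// ?divr_gt0//.
  rewrite invfM invrK mulrC mulrC.
  apply: (@lt_le_trans _ _ k%:R); last by rewrite ler_nat.
  by rewrite archi_boundP// mulr_ge0// invr_ge0 ltW.
have k0 : 0 < k.+1%:R^-1 :> R by rewrite invr_gt0.
have /= H (i : 'I_n) : exists q : rat, x 0 i - k.+1%:R^-1 < ratr q < x 0 i + k.+1%:R^-1.
  have xk : x 0 i - k.+1%:R^-1 < x 0 i + k.+1%:R^-1.
    by rewrite ltrBlDr -addrA ltrDl addr_gt0.
  have [q] := rat_in_itvoo xk.
  by rewrite in_itv/=; exists q.
have {H}[f fP] := choice H.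
exists (\row_i f i, k).
  move=> y /= yP; apply: eO; rewrite mx_norm_ball /ball_/=.
  apply/rV_norm_ltP => // i; have := yP i; have := fP i; rewrite !mxE/=.
  move: k0 ke; set r : R := _^-1 => k0 ke /andP[h1 h2] /andP[h3 h4].
  by rewrite ltr_norml; apply/andP; split; lra.
move=> i; have := fP i; rewrite !mxE/= mul1r; set r : R := _^-1 => /andP[h1 h2].
by apply/andP; split; lra.
Qed.

Lemma open_measurable_rV O : open O -> measurable O.
Proof.
move=> /open_rcube ->; rewrite bigcup_mkcond.
apply: countable_bigcupT_measurable => // p.
by case: ifP => // _; exact: measurable_hbox.
Qed.

Lemma closed_measurable_rV K : closed K -> measurable K.
Proof.
by move=> cK; rewrite -(setCK K); apply: measurableC; apply: open_measurable_rV;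
  exact: closed_openC.
Qed.

Lemma compact_measurable_rV K : compact K -> measurable K.
Proof.
move=> cK; apply: closed_measurable_rV; apply: compact_closed => //.
Qed.

Lemma continuous_measurable_rV (f : 'rV[R]_n -> R) :
  continuous f -> measurable_fun setT f.
Proof.
move=> cf; apply: (measurability _ (RGenOpens.measurableE R)) => /=.
move=> _ [_ [a [b ->] <-]]; rewrite setTI; apply: open_measurable_rV.
by move/continuousP : cf; apply; exact: interval_open.
Qed.

Lemma bounded_sub_cbox A : bounded_set A ->
  exists2 M, 0 < M & A `<=` cbox (const_mx (- M)) (const_mx M).
Proof.
move=> [M [_ hM]]; exists (`|M| + 1); first by rewrite ltr_wpDl.
move=> x /(hM (`|M| + 1) (le_lt_trans (ler_norm M) _)) h i; rewrite !mxE.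
have {}h : `|x| <= `|M| + 1 by apply: h; rewrite ltrDl.
rewrite -ler_norml; apply: (rV_norm_leP x _).1 => //.
Qed.

Lemma bounded_fin A : measurable A -> bounded_set A -> (mu A < +oo)%E.
Proof.
move=> mA /bounded_sub_cbox[M _ AM].
apply: le_lt_trans (cbox_fin (const_mx (- M)) (const_mx M)).
by apply: le_measure; rewrite ?inE//; exact: measurable_cbox.
Qed.

Lemma compact_fin K : compact K -> (mu K < +oo)%E.
Proof.
move=> cK; apply: bounded_fin; first exact: compact_measurable_rV.
exact: compact_bounded.
Qed.

End boxes.

(** * Smooth bump functions *)

Section flat_functions.
Context (R : realType).
Implicit Types (p : {poly R}) (f g : R -> R) (s t : R).

Lemma horner_le_expn p : exists A d, forall s, 1 <= s -> `|p.[s]| <= A * s ^+ d.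
Proof.
elim/poly_ind: p => [|p c [A [d IH]]].
  by exists 0, 0%N => s _; rewrite horner0 normr0 mul0r.
exists (A + `|c|), d.+1 => s s1; have s0 : 0 <= s by exact: le_trans s1.
rewrite hornerD hornerM hornerX hornerC (le_trans (ler_normD _ _))//.
rewrite mulrDl lerD//.
  by rewrite normrM (ger0_norm s0) exprSr mulrA ler_wpM2r// IH.
by rewrite ler_peMr// exprn_ege1.
Qed.

(* The iterated derivatives of exp(- 1 / t), extended by 0 to t <= 0, are all of
   this form. *)
Definition flat p t : R := if 0 < t then p.[t^-1] * expR (- t^-1) else 0.

(** With s = 1/t, the polynomial is at most A s^d while exp(s) >= s^(d+2) / (d+2)!, which leaves a
    factor t^2. A quadratic bound is what makes the derivative at 0 vanish. *)
Lemma flat_le p : exists C, forall t, `|t| <= 1 -> `|flat p t| <= C * t ^+ 2.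
Proof.
have [A [d hA]] := horner_le_expn p.
have A0 : 0 <= A.
  by have := hA 1 (lexx _); rewrite expr1n mulr1; apply: le_trans.
exists (A * (d.+2)`!%:R) => t t1; rewrite /flat; case: ifPn => [t0|_]; last first.
  by rewrite normr0 mulr_ge0// ?sqr_ge0// mulr_ge0.
set s := t^-1; have s0 : 0 < s by rewrite invr_gt0.
have s1 : 1 <= s by rewrite invf_ge1// (le_trans _ t1)// ler_norm.
rewrite normrM expRN normfV (ger0_norm (expR_ge0 _)).
rewrite ler_pdivrMr ?expR_gt0//; apply: le_trans (hA _ s1) _.
have := expR_ge1Dxn d.+1 (ltW s0) => hs.
apply: (@le_trans _ _ (A * (d.+2)`!%:R * t ^+ 2 * (s ^+ d.+2 / (d.+2)`!%:R))).
  have -> : s ^+ d.+2 = s ^+ d * s ^+ 2 by rewrite -exprD addn2.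
  have -> : A * (d.+2)`!%:R * t ^+ 2 * (s ^+ d * s ^+ 2 / (d.+2)`!%:R) =
    A * s ^+ d * ((t * s) ^+ 2) * ((d.+2)`!%:R / (d.+2)`!%:R).
    by rewrite exprMn; ring.
  have -> : (d.+2)`!%:R / (d.+2)`!%:R = 1 :> R.
    by rewrite divff// pnatr_eq0 -lt0n fact_gt0.
  have -> : t * s = 1 by rewrite /s mulfV// gt_eqF.
  by rewrite expr1n !mulr1.
apply: ler_wpM2l; first by rewrite mulr_ge0 ?sqr_ge0// mulr_ge0.
by apply: le_trans hs; rewrite lerDr.
Qed.

(** Since s = 1/t has derivative - s^2, the derivative of p(s) exp(- s) is s^2 (p(s) - p'(s)) exp(-
    s), again of the same form. At 0 the difference quotient is bounded by a multiple of |h| thanks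
    to [flat_le]. *)
Lemma is_derive_flat p t : is_derive t 1 (flat p) (flat ('X ^+ 2 * (p^`() * -1 + p)) t).
Proof.
have [t0|t0|->] := ltgtP t 0.
- rewrite {2}/flat ltNge (ltW t0)/=.
  apply: (@near_eq_is_derive _ _ _ (cst 0)) => //.
  near=> y; rewrite /flat/=; case: ifPn => // y0.
  suff : y < 0 by rewrite ltNge (ltW y0).
  by near: y; exact: lt_nbhsl.
- have tV : is_derive t 1 (fun x : R => x^-1) (- t ^- 2 *: 1).
    by apply: is_deriveV; rewrite ?gt_eqF.
  have tN : is_derive t 1 (fun x : R => - x^-1) (- (- t ^- 2 *: 1)).
    exact: is_deriveN.
  have e : is_derive t 1 (fun x : R => expR (- x^-1)) (expR (- t^-1) * - (- t ^- 2 *: 1)).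
    exact: (@is_derive1_comp _ expR (fun x => - x^-1)).
  have h : is_derive t 1 (fun x : R => p.[x^-1]) (p^`().[t^-1] * (- t ^- 2 *: 1)).
    exact: (@is_derive1_comp _ (horner p) (fun x => x^-1)).
  apply: (@near_eq_is_derive _ _ _ (fun x : R => p.[x^-1] * expR (- x^-1))) => //.
    near=> y; rewrite /flat/=; case: ifPn => // /negP[].
    by near: y; exact: lt_nbhsr.
  apply: (is_derive_eq (is_deriveM h e)).
  rewrite /flat t0 !(hornerM, hornerD, hornerN, hornerX, hornerE).
  rewrite /GRing.scale/= -exprVn.
  by rewrite /GRing.scale/=; ring.
- rewrite {2}/flat ltxx.
  have [C hC] := flat_le p.
  have C0 : 0 <= C.
    have := hC 1; rewrite normr1 expr1n mulr1 => /(_ (lexx _)).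
    by apply: le_trans.
  have cv : h^-1 *: (flat p (h *: (1 : R) + 0) - flat p 0) @[h --> 0^'] --> (0 : R).
    apply/cvgr0Pnorm_le => e e0; near=> h.
    have f0 : flat p 0 = 0 by rewrite /flat ltxx.
    have h0 : h != 0 by near: h; exact: nbhs_dnbhs_neq.
    rewrite f0 subr0 addr0 [_ *: (1 : R)]mulr1 normrM normfV.
    rewrite ler_pdivrMl ?normr_gt0//.
    have h1 : `|h| <= 1 by near: h; exact: dnbhs0_le.
    apply: le_trans (hC _ h1) _.
    rewrite -normr_id -real_normK ?num_real// normr_id.
    rewrite expr2 mulrA mulrC; apply: ler_wpM2l => //.
    have he : `|h| <= e / (C + 1).
      by near: h; apply: dnbhs0_le; rewrite divr_gt0// ltr_wpDl.
    apply: le_trans (ler_wpM2l C0 he) _.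
    by rewrite mulrCA ger_pMr// ler_pdivrMr ?ltr_wpDl// mul1r lerDl.
  apply: DeriveDef; first by apply/cvg_ex; exists 0.
  exact/cvg_lim.
Unshelve. all: by end_near. Qed.

(** C^k on the line, with the derivative carried as a witness, so that closure under sums, products
    and affine substitutions follows by induction on k. *)
Fixpoint smooth1 (k : nat) f : Prop :=
  match k with
  | 0 => continuous f
  | k'.+1 => exists2 f', (forall t, is_derive t 1 f (f' t)) & smooth1 k' f'
  end.

Lemma is_derive_continuous f f' : (forall t, is_derive t 1 f (f' t)) -> continuous f.
Proof.
move=> df t; apply: differentiable_continuous; apply/derivable1_diffP.
by have [] := df t.
Qed.

Lemma smooth1_continuous k f : smooth1 k f -> continuous f.
Proof. by case: k => // k [f' df _]; exact: is_derive_continuous df. Qed.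

Lemma smooth1S k f : smooth1 k.+1 f -> smooth1 k f.
Proof.
elim: k f => [|k IH] f; first exact: smooth1_continuous.
by move=> [f' df /IH sf']; exists f'.
Qed.

Lemma smooth1_flat k p : smooth1 k (flat p).
Proof.
elim: k p => [|k IH] p; first exact: is_derive_continuous (is_derive_flat p).
by exists (flat ('X ^+ 2 * (p^`() * -1 + p))) => //; exact: is_derive_flat.
Qed.

Lemma smooth1D k f g : smooth1 k f -> smooth1 k g -> smooth1 k (fun t => f t + g t).
Proof.
elim: k f g => [|k IH] f g; first by move=> cf cg t; apply: cvgD; [exact: cf|exact: cg].
move=> [f' df sf] [g' dg sg]; exists (fun t => f' t + g' t); last exact: IH.
by move=> t; exact: is_deriveD.
Qed.

Lemma smooth1M k f g : smooth1 k f -> smooth1 k g -> smooth1 k (fun t => f t * g t).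
Proof.
elim: k f g => [|k IH] f g; first by move=> cf cg t; apply: cvgM; [exact: cf|exact: cg].
move=> sf sg; have := sf; have := sg.
move=> [g' dg sg'] [f' df sf'].
exists (fun t => f t * g' t + g t * f' t); first by move=> t; exact: is_deriveM.
by apply: smooth1D; apply: IH => //; exact: smooth1S.
Qed.

Lemma smooth1_cst k (c : R) : smooth1 k (fun=> c).
Proof.
elim: k c => [|k IH] c; first by move=> t; exact: cvg_cst.
by exists (cst 0); [move=> t; exact: is_derive_cst|exact: IH].
Qed.

Lemma smooth1_affine k f (c d : R) : smooth1 k f -> smooth1 k (fun t => f (c * t + d)).
Proof.
have da t : is_derive t 1 (fun t => c * t + d) c.
  have H := is_deriveD (is_deriveZ c (is_derive_id t (1 : R))) (is_derive_cst d t (1 : R)).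
  by apply: (is_derive_eq H); rewrite addr0 [_ *: _]mulr1.
elim: k f => [|k IH] f.
  move=> cf t; apply: continuous_comp; last exact: cf.
  exact: (is_derive_continuous da).
move=> [f' df sf]; exists (fun t => f' (c * t + d) * c).
  by move=> t; exact: is_derive1_comp.
by apply: smooth1M; [exact: IH|exact: smooth1_cst].
Qed.

End flat_functions.

Section bumps1.
Context (R : realType).
Implicit Types (f g : R -> R) (s t a b : R).

(** This is [flat 1 (s (t - a)) * flat 1 (s (b - t))]: for s > 0 it vanishes outside ]a, b[, and s
    governs its steepness. The arguments are spelled as c t + d to match [smooth1_affine]. *)
Definition bump1 s a b t : R := flat 1 (s * t + - (s * a)) * flat 1 (- s * t + s * b).

Lemma smooth1_bump1 k s a b : smooth1 k (bump1 s a b).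
Proof. by apply: smooth1M; apply: smooth1_affine; exact: smooth1_flat. Qed.

Lemma flat1E t : flat 1 t = if 0 < t then expR (- t^-1) else 0.
Proof. by rewrite /flat hornerC mul1r. Qed.

Lemma flat1_ge0 t : 0 <= flat 1 t.
Proof. by rewrite flat1E; case: ifP => // _; exact: expR_ge0. Qed.

Lemma flat1_le1 t : flat 1 t <= 1.
Proof.
rewrite flat1E; case: ifP => // t0.
by rewrite expR_le1// oppr_le0 invr_ge0 ltW.
Qed.

Lemma bump1_ge0 s a b t : 0 <= bump1 s a b t.
Proof. by rewrite mulr_ge0 ?flat1_ge0. Qed.

Lemma bump1_le1 s a b t : bump1 s a b t <= 1.
Proof. by rewrite mulr_ile1 ?flat1_ge0 ?flat1_le1. Qed.

Lemma bump1_neq0 s a b t : 0 < s -> bump1 s a b t != 0 -> a < t < b.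
Proof.
move=> s0; rewrite mulf_eq0 negb_or !flat1E => /andP[].
case: ifP => [h1 _|]; last by rewrite eqxx.
case: ifP => [h2 _|]; last by rewrite eqxx.
move: h1 h2; rewrite -mulrBr pmulr_rgt0// subr_gt0 => ->.
by rewrite mulNr addrC -mulrBr pmulr_rgt0// subr_gt0.
Qed.

(** A continuous function vanishing outside a segment is integrable on the line, so its integral
    from -oo is a primitive on all of R. *)
Lemma antiderivative (f : R -> R) a b : continuous f ->
  (forall t, f t != 0 -> a <= t <= b) ->
  exists F : R -> R, forall t, is_derive t 1 F (f t).
Proof.
move=> cf f0.
have fE : f = f \_ `[a, b].
  apply/funext => t; rewrite patchE; case: ifPn => //.
  rewrite notin_setE/= in_itv/=; have [->//|/f0 ->//] := eqVneq (f t) 0.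
have intf : (@lebesgue_measure R).-integrable setT (EFin \o f).
  rewrite fE -restrict_EFin; apply/integrable_restrict => //=.
  rewrite setTI; apply: continuous_compact_integrable => //.
    exact: segment_compact.
  by apply: continuous_subspaceT.
exists (fun t => \int[lebesgue_measure]_(r in [set` Interval -oo%O (BRight t)]) f r) => t.
have [|||df fE'] := @continuous_FTC1 R f -oo%O t (t + 1) _ _ _ (cf t).
- by rewrite ltrDl.
- by apply: integrableS intf.
- by rewrite ltNyr.
by apply: DeriveDef; [exact: df|rewrite -derive1E; exact: fE'].
Qed.

Lemma smooth1_antiderivative k f F :
  (forall t, is_derive t 1 F (f t)) -> smooth1 k f -> smooth1 k F.
Proof. by move=> dF sf; apply: smooth1S; exists f. Qed.

Lemma cvg_flat1_exp (t : R) : 0 < t -> flat 1 (m.+1%:R * t) @[m --> \oo] --> (1 : R).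
Proof.
move=> t0.
rewrite (_ : (fun m => _) = (fun m => expR (- (m.+1%:R^-1 * t^-1)))); last first.
  apply/funext => m; rewrite flat1E mulr_gt0//.
  by congr (expR (- _)); rewrite invfM mulrC.
rewrite -[X in _ --> X](@expR0 R); apply: continuous_cvg; first exact: continuous_expR.
rewrite -[X in _ --> X]oppr0; apply: cvgN.
rewrite -[X in _ --> X](mul0r t^-1); apply: cvgMr_tmp.
exact: (@cvg_harmonic R).
Qed.

(* Converges to the indicator function of ]a, b] (and not of ]a, b[), so that
   boundaries of boxes need no separate treatment. *)
Lemma cvg_bump1 d a b t : 0 < d ->
  bump1 (m.+1%:R ^+ 2) a (b + d / m.+1%:R) t @[m --> \oo] --> (\1_`]a, b] t : R).
Proof.
move=> d0.
(* The slope (m+1)^2 outweighs the displacement d/(m+1): the second argument is at least (m+1) d for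
   t <= b, in particular at t = b, and is eventually negative for t > b. *)
have E m : bump1 (m.+1%:R ^+ 2) a (b + d / m.+1%:R) t =
    flat 1 (m.+1%:R * (m.+1%:R * (t - a))) *
    flat 1 (m.+1%:R * (m.+1%:R * (b - t) + d)).
  rewrite /bump1; congr (flat 1 _ * flat 1 _); first by ring.
  by field; rewrite lt0r_neq0// (lt_le_trans ltr01)// ler1n.
under eq_fun do rewrite E.
have m1 m : 1 <= m.+1%:R :> R by rewrite ler1n.
have [ta|ta] := leP t a.
  rewrite indicE memNset ?mulr0n; last by rewrite /= in_itv/= ltNge ta.
  apply: cvg_near_cst; apply: nearW => m.
  rewrite [flat 1 _]flat1E ltNge ifN ?mul0r// negbK.
  by rewrite mulr_ge0_le0// mulr_ge0_le0// subr_le0.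
have ta0 : 0 < t - a by rewrite subr_gt0.
have c1 : flat 1 (m.+1%:R * (m.+1%:R * (t - a))) @[m --> \oo] --> (1 : R).
  apply: (@squeeze_cvgr _ _ _ _ (fun m => flat 1 (m.+1%:R * (t - a))) (cst 1)).
  - near=> m; rewrite flat1_le1 andbT !flat1E.
    have tm : 0 < m.+1%:R * (t - a) by rewrite mulr_gt0.
    rewrite tm mulr_gt0// ler_expR lerN2 lef_pV2 ?posrE ?mulr_gt0//.
    by rewrite ler_peMl// ltW// mulr_gt0.
  - exact: cvg_flat1_exp.
  - exact: cvg_cst.
have [bt|bt] := leP t b.
  rewrite indicE mem_set ?mulr1n; last by rewrite /= in_itv/= ta.
  suff c2 : flat 1 (m.+1%:R * (m.+1%:R * (b - t) + d)) @[m --> \oo] --> (1 : R).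
    have := cvgM c1 c2; have -> : (1 : R) * 1 = 1 by rewrite mulr1. exact.
  apply: (@squeeze_cvgr _ _ _ _ (fun m => flat 1 (m.+1%:R * d)) (cst 1)).
  - near=> m; rewrite flat1_le1 andbT !flat1E.
    have tm : 0 < m.+1%:R * d by rewrite mulr_gt0.
    have td : d <= m.+1%:R * (b - t) + d by rewrite lerDr mulr_ge0// subr_ge0.
    rewrite tm mulr_gt0// ?(lt_le_trans d0)//.
    rewrite ler_expR lerN2 lef_pV2 ?posrE ?mulr_gt0// ?(lt_le_trans d0)//.
    by rewrite ler_pM2l.
  - exact: cvg_flat1_exp.
  - exact: cvg_cst.
rewrite indicE memNset ?mulr0n; last by rewrite /= in_itv/= ta leNgt bt.
apply: cvg_near_cst; near=> m.
rewrite [X in _ * X]flat1E ltNge ifN ?mulr0// negbK.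
rewrite mulr_ge0_le0//.
rewrite -lerBrDr sub0r -opprB mulrN lerN2 -ler_pdivrMr ?subr_gt0//.
have : (Num.bound (d / (t - b)) <= m)%N by near: m; exists (Num.bound (d / (t - b))).
rewrite -(ler_nat R) => h; apply: le_trans (ltW _) (le_trans h _).
  by apply: archi_boundP; rewrite divr_ge0 ?subr_ge0// ltW.
by rewrite ler_nat.
Unshelve. all: by end_near. Qed.

End bumps1.

Lemma cvg_prodr (R : realType) (T I : Type) (F : set_system T) (FF : Filter F)
    (r : seq I) (f : I -> T -> R) (l : I -> R) :
  (forall i, f i t @[t --> F] --> l i) ->
  \prod_(i <- r) f i t @[t --> F] --> \prod_(i <- r) l i.
Proof.
move=> fl; elim: r => [|i r IH].
  by rewrite big_nil; under eq_fun do rewrite big_nil; exact: cvg_cst.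
by rewrite big_cons; under eq_fun do rewrite big_cons; exact: cvgM.
Qed.

(** * Test functions of product form *)

Section test_functions.
Context (R : realType) (n : nat).
Implicit Types (a b x : 'rV[R]_n) (O : set 'rV[R]_n) (f : 'I_n -> R -> R).

Definition prod_fun f x : R := \prod_i f i (x 0 i).

Local Notation e_ i := (delta_mx 0 i : 'rV[R]_n).

Lemma is_derive_line (phi : 'rV[R]_n -> R) (v x : 'rV[R]_n) (g : R -> R) (t d : R) :
  (forall h, phi (h *: v + x) = g (h + t)) -> is_derive t 1 g d ->
  is_derive x v phi d.
Proof.
move=> hg [dg dE].
have x0 : phi x = g t by have := hg 0; rewrite scale0r !add0r.
have E : (fun h => h^-1 *: ((phi \o shift x) (h *: v) - phi x)) =
         (fun h => h^-1 *: ((g \o shift t) (h *: (1 : R)) - g t)).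
  by apply/funext => h; rewrite /= hg x0 [_ *: (1 : R)]mulr1.
by apply: DeriveDef; [rewrite /derivable E|rewrite /derive E].
Qed.

Lemma is_derive_line1 (phi : 'rV[R]_n -> R) (v x : 'rV[R]_n) (t : R) :
  derivable phi (x + t *: v) v ->
  is_derive t 1 (fun s => phi (x + s *: v)) ('D_v phi (x + t *: v)).
Proof.
move=> df.
have E : (fun h => h^-1 *: ((phi \o shift (x + t *: v)) (h *: v) - phi (x + t *: v))) =
         (fun h => h^-1 *: (((fun s => phi (x + s *: v)) \o shift t) (h *: (1 : R)) -
            phi (x + t *: v))).
  apply/funext => h; rewrite /= [_ *: (1 : R)]mulr1; congr (_ *: (phi _ - _)).
  by rewrite scalerDl addrCA.
by apply: DeriveDef; [rewrite /derivable -E|rewrite /derive -E].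
Qed.

Lemma coordD_delta i j (h : R) x : (h *: e_ i + x) 0 j = x 0 j + h *+ (j == i).
Proof. by rewrite !mxE eqxx/= mulr_natr addrC. Qed.

Lemma is_derive_prod_fun f i (f' : R -> R) x :
  (forall t : R, is_derive t 1 (f i) (f' t)) ->
  is_derive x (e_ i) (prod_fun f) (prod_fun (fun j => if j == i then f' else f j) x).
Proof.
move=> df; pose C := \prod_(j | j != i) f j (x 0 j).
have H := is_deriveZ C (df (x 0 i)).
have H' : is_derive x (e_ i) (prod_fun f) (C *: f' (x 0 i)).
  apply: (is_derive_line _ H) => h.
  rewrite /prod_fun (bigD1 i)//= coordD_delta eqxx mulr1n [C *: _]mulrC addrC.
  congr (_ * _); apply: eq_bigr => j /negbTE ji.
  by rewrite coordD_delta ji addr0.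
apply: (is_derive_eq H').
rewrite /prod_fun (bigD1 i)//= eqxx [C *: _]mulrC; congr (_ * _).
by apply: eq_bigr => j /negbTE ->.
Qed.

Lemma continuous_prod_fun f : (forall i, continuous (f i)) -> continuous (prod_fun f).
Proof.
move=> cf x; apply: (@cvg_prodr _ _ _ (nbhs x)) => i.
by apply: continuous_comp; [exact: coord_continuous|exact: cf].
Qed.

(** A partial derivative in direction [i] only replaces the factor [f i] by its derivative, so the
    product form persists and the induction closes. *)
Lemma classC_prod_fun k f : (forall j, smooth1 k (f j)) -> classC k (prod_fun f).
Proof.
elim: k f => [|k IH] f sf; first exact: continuous_prod_fun.
split; first by apply: continuous_prod_fun => i; exact: smooth1_continuous (sf i).
move=> i; have [f' df sf'] := sf i; split.
  by move=> x; have [] := is_derive_prod_fun x df.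
rewrite (_ : partial i (prod_fun f) =
    prod_fun (fun j => if j == i then f' else f j)).
  by apply: IH => j; case: ifP => // _; exact: smooth1S.
by apply/funext => x; have [_] := is_derive_prod_fun x df.
Qed.

Lemma cbox_closed a b : closed (cbox a b).
Proof.
by apply: compact_closed; [exact: norm_hausdorff|exact: cbox_compact].
Qed.

Lemma prod_fun_support f a b : (forall j t, f j t != 0 -> a 0 j <= t <= b 0 j) ->
  closure [set x | prod_fun f x != 0] `<=` cbox a b.
Proof.
move=> hf; rewrite (closure_id (cbox a b)).1; last exact: cbox_closed.
apply: closure_subset => x /= + i.
by rewrite /prod_fun => /prodf_neq0/(_ i isT)/hf.
Qed.

Lemma test_prod_fun O f a b : (forall k j, smooth1 k (f j)) ->
  (forall j t, f j t != 0 -> a 0 j <= t <= b 0 j) ->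
  cbox a b `<=` O -> test_function O (prod_fun f).
Proof.
move=> sf hf abO; have sub := prod_fun_support hf.
have cc : compact (closure [set x | prod_fun f x != 0]).
  have cl : closed (closure [set x | prod_fun f x != 0]) by exact: closed_closure.
  exact: (subclosed_compact cl (@cbox_compact R n a b) sub).
split.
- by move=> k; exact: classC_prod_fun.
- exact: cc.
- exact: subset_trans abO.
Qed.

Definition box_bump (s : R) a b : 'rV[R]_n -> R :=
  prod_fun (fun j => bump1 s (a 0 j) (b 0 j)).

Lemma continuous_box_bump s a b : continuous (box_bump s a b).
Proof.
apply: continuous_prod_fun => j.
exact: smooth1_continuous (smooth1_bump1 0 s (a 0 j) (b 0 j)).
Qed.

Lemma box_bump_ge0 s a b x : 0 <= box_bump s a b x.
Proof. by apply: prodr_ge0 => j _; exact: bump1_ge0. Qed.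

Lemma box_bump_le1 s a b x : box_bump s a b x <= 1.
Proof.
apply: (@le_trans _ _ (\prod_(j < n) 1)); last by rewrite big1.
by apply: ler_prod => j _; rewrite bump1_ge0 bump1_le1.
Qed.

Lemma box_bump_neq0 s a b x : 0 < s -> box_bump s a b x != 0 -> cbox a b x.
Proof.
move=> s0 /prodf_neq0 h i.
by have /andP[/ltW -> /ltW ->] := bump1_neq0 s0 (h i isT).
Qed.

Lemma test_box_bump O s a b : 0 < s -> cbox a b `<=` O -> test_function O (box_bump s a b).
Proof.
move=> s0; apply: test_prod_fun; first by move=> k j; exact: smooth1_bump1.
by move=> j t /(bump1_neq0 s0)/andP[/ltW -> /ltW ->].
Qed.

Lemma cvg_box_bump d a b x : 0 < d ->
  box_bump (m.+1%:R ^+ 2) a (\row_j (b 0 j + d / m.+1%:R)) x @[m --> \oo] -->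
    (\1_(hbox a b) x : R).
Proof.
move=> d0; have -> : \1_(hbox a b) x = \prod_j (\1_`]a 0 j, b 0 j] (x 0 j) : R).
  have [xab|xab] := pselect (hbox a b x).
    rewrite indicE mem_set// big1// => j _; rewrite indicE mem_set//=.
    by rewrite in_itv/=; exact: xab.
  rewrite indicE memNset//; move: xab => /existsNP[j /negP xj].
  by rewrite (bigD1 j)//= indicE memNset ?mul0r// => /=; rewrite in_itv/=; exact/negP.
rewrite /box_bump /prod_fun; under eq_fun do under eq_bigr do rewrite mxE.
by apply: cvg_prodr => j; exact: cvg_bump1.
Qed.

(* [psi] is the bump averaged over translations in direction i; being the
   product of bumps and of a difference of primitives of a bump, it is a test
   function. *)
Lemma step_function O s a b i (h : R) : 0 < s -> 0 < h ->
  cbox a (b + h *: e_ i) `<=` O ->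
  exists psi, [/\ test_function O psi,
    forall x, partial i psi x = box_bump s a b x - box_bump s a b (x - h *: e_ i) &
    forall x, psi x = \int[lebesgue_measure]_(t in `[0, h]) box_bump s a b (x - t *: e_ i)].
Proof.
move=> s0 h0 abO; pose beta := bump1 s (a 0 i) (b 0 i).
have sb k : smooth1 k beta by exact: smooth1_bump1.
have beta0 t : beta t != 0 -> a 0 i <= t <= b 0 i.
  by move=> /(bump1_neq0 s0)/andP[/ltW -> /ltW ->].
have [B dB] := antiderivative (smooth1_continuous (sb 0)) beta0.
have dBh (t : R) : is_derive t 1 (fun t => B (1 * t + - h)) (beta (t - h)).
  rewrite -[t in beta (t - h)]mul1r.
  have H := is_deriveD (is_deriveZ (1 : R) (is_derive_id t (1 : R)))
    (is_derive_cst (- h) t (1 : R)).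
  apply: (is_derive_eq (is_derive1_comp (dB _) H)).
  by rewrite addr0 [_ *: (1 : R)]mulr1 mulr1.
(* B(t) - B(t - h), the integral of [beta] over [t - h, t]. Unlike the primitive [B] itself it
   vanishes outside [a_i, b_i + h], which makes the product compactly supported. *)
pose gamma t := B t + -1 * B (1 * t + - h).
have dg (t : R) : is_derive t 1 gamma (beta t - beta (t - h)).
  apply: (is_derive_eq (is_deriveD (dB t) (is_deriveZ (-1) (dBh t)))).
  by rewrite scaleN1r.
have sg k : smooth1 k gamma.
  have sB : smooth1 k B := smooth1_antiderivative dB (sb k).
  by apply: smooth1D => //; apply: smooth1M; [exact: smooth1_cst|exact: smooth1_affine].
have cbt (t : R) : continuous (fun r : R => beta (-1 * r + t)).
  exact: smooth1_continuous (smooth1_affine (-1) t (sb 0)).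
have gE t : gamma t = \int[lebesgue_measure]_(r in `[0, h]) beta (-1 * r + t).
  have dF (r : R) : is_derive r 1 (fun r : R => -1 * B (-1 * r + t)) (beta (-1 * r + t)).
    have H := is_deriveD (is_deriveZ (-1 : R) (is_derive_id r (1 : R)))
      (is_derive_cst t r (1 : R)).
    apply: (is_derive_eq (is_deriveZ (-1) (is_derive1_comp (dB _) H))).
    rewrite addr0 [_ *: (1 : R)]mulr1 [_ *: _]mulrA.
    by rewrite mulrC !mulrA mulrNN mulr1 mul1r.
  have cF := is_derive_continuous dF.
  rewrite /Rintegral (@continuous_FTC2 _ _ (fun r : R => -1 * B (-1 * r + t))) //.
  - rewrite -EFinB/= /gamma !mulN1r oppr0 add0r mul1r opprK [RHS]addrC.
    by rewrite (addrC (- h)).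
  - exact: continuous_subspaceT.
  - split; first by move=> r _; have [] := dF r.
      by apply: cvg_at_right_filter; exact: cF.
    by apply: cvg_at_left_filter; exact: cF.
  - by move=> r _; rewrite derive1E; have [] := dF r.
have g0 t : gamma t != 0 -> a 0 i <= t <= b 0 i + h.
  apply: contraNT; rewrite negb_and -!ltNge => /orP H; apply/eqP.
  rewrite gE /Rintegral integral0_eq// => r; rewrite /= in_itv/= => /andP[r0 rh].
  congr (_%:E); apply/eqP; apply: contraT => /beta0/andP[].
  by case: H => H; rewrite !mulN1r; lra.
pose f j := if j == i then gamma else bump1 s (a 0 j) (b 0 j).
exists (prod_fun f); split.
- apply: (test_prod_fun _ _ abO).
    by move=> k j; rewrite /f; case: ifP => // _; exact: smooth1_bump1.
  move=> j t; rewrite /f !mxE eqxx/=; have [->|_] /= := eqVneq j i.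
    by rewrite mulr1; exact: g0.
  by rewrite mulr0 addr0 => /(bump1_neq0 s0)/andP[/ltW -> /ltW ->].
- move=> x; have dg' : forall t : R, is_derive t 1 (f i) (beta t - beta (t - h)).
    by move=> t; rewrite /f eqxx.
  rewrite /partial; have [_ ->] := is_derive_prod_fun x dg'.
  rewrite /box_bump /prod_fun [LHS](bigD1 i)//= [X in _ = X - _](bigD1 i)//=.
  rewrite [X in _ = _ - X](bigD1 i)//= eqxx !mxE !eqxx/= mulr1 mulrBl.
  congr (_ * _ - _ * _); apply: eq_bigr => j /negbTE ji; rewrite /f ji//.
  by rewrite !mxE ji/= mulr0 subr0.
- move=> x; rewrite /prod_fun (bigD1 i)//= {1}/f eqxx gE.
  rewrite -RintegralZr//; last first.
    apply: continuous_compact_integrable; first exact: segment_compact.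
    exact: continuous_subspaceT.
  apply: eq_Rintegral => t _; rewrite /box_bump /prod_fun [RHS](bigD1 i)//= !mxE !eqxx/=.
  rewrite mulr1 mulN1r addrC; congr (_ * _); apply: eq_bigr => j /negbTE ji.
  by rewrite /f !mxE ji/= mulr0 subr0.
Qed.

End test_functions.

(** * Fundamental lemma of the calculus of variations *)

Section fundamental_lemma.
Context (R : realType) (n : nat).
Implicit Types (a b x : 'rV[R]_n) (O A D : set 'rV[R]_n) (f : 'rV[R]_n -> R).
Local Notation mu := (lebesgue_rV R n).

Lemma Rintegral_support A D f : A `<=` D -> (forall x, f x != 0 -> A x) ->
  \int[mu]_(x in D) f x = \int[mu]_(x in A) f x.
Proof.
move=> AD fA; rewrite Rintegral_mkcond [RHS]Rintegral_mkcond; congr (Rintegral _ _ _).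
apply/funext => x; rewrite !patchE; have [Ax|Ax] := pselect (A x).
  by rewrite !mem_set//; exact: AD.
rewrite (memNset Ax); case: ifP => // _.
by apply/eqP; apply: contra_notT Ax => /fA.
Qed.

(** Dominated convergence, with dominating function |f|, along bumps tending to the indicator of the
    half-open box. Their supports exceed the box by d/(m+1) at the upper faces only, hence the
    one-sided margin [d]. *)
Lemma integral_hbox_eq0 O f a b (d : R) : locally_integrable_on O f ->
  (forall (s : R) a b, 0 < s -> cbox a b `<=` O ->
    \int[mu]_(x in cbox a b) (f x * box_bump s a b x) = 0) ->
  0 < d -> cbox a (b + const_mx d) `<=` O ->
  (\int[mu]_(x in hbox a b) (f x)%:E = 0)%E.
Proof.
move=> lf f0 d0; set C := cbox a _ => CO.
have mC : measurable C by exact: measurable_cbox.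
have intf : mu.-integrable C (EFin \o f) by apply: lf CO; exact: cbox_compact.
have mf : measurable_fun C f by apply/measurable_EFinP; exact: measurable_int intf.
pose bm m := (\row_j (b 0 j + d / m.+1%:R)) : 'rV[R]_n.
have s0 m : 0 < m.+1%:R ^+ 2 :> R by rewrite exprn_gt0.
have bC m : cbox a (bm m) `<=` C.
  move=> x h j; have /andP[-> /= hb] := h j; apply: le_trans hb _.
  by rewrite !mxE lerD2l ler_pdivrMr// ler_peMr ?ler1n// ltW.
have hC : hbox a b `<=` C.
  move=> x h j; have /andP[/ltW -> /= hb] := h j; apply: le_trans hb _.
  by rewrite !mxE lerDl ltW.
have mb m : measurable_fun C (box_bump (m.+1%:R ^+ 2) a (bm m)).
  apply: (measurable_funS measurableT) => //.
  by apply: continuous_measurable_rV; exact: continuous_box_bump.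
have [||||| _ _ cvg] := @dominated_convergence _ _ _ mu C mC
  (fun m x => (f x * box_bump (m.+1%:R ^+ 2) a (bm m) x)%:E)
  (fun x => (f x * \1_(hbox a b) x)%:E) (fun x => `|f x|%:E) _ _ _ _ _.
- by move=> m; apply/measurable_EFinP; exact: measurable_funM.
- apply/measurable_EFinP; apply: measurable_funM => //.
  by apply: measurable_indic; exact: measurable_hbox.
- apply: aeW => x Cx; apply: cvg_EFin; first exact: nearW.
  by apply: cvgM; [exact: cvg_cst|exact: cvg_box_bump].
- exact: (integrable_abse intf).
- apply: aeW => x m Cx /=; rewrite lee_fin normrM ler_piMr//.
  by rewrite ger0_norm ?box_bump_ge0// box_bump_le1.
have H : (\int[mu]_(x in C) (f x * \1_(hbox a b) x)%:E = 0)%E.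
  apply/esym/(cvg_unique _ _ cvg) => //.
  rewrite [X in X @ _](_ : _ = cst 0%E); first exact: cvg_cst.
  apply/funext => m /=.
  have intm : mu.-integrable C
      (EFin \o (fun x => f x * box_bump (m.+1%:R ^+ 2) a (bm m) x)).
    apply: (le_integrable mC _ _ intf) => /=.
      by apply/measurable_EFinP; exact: measurable_funM.
    move=> x _; rewrite /= lee_fin normrM ler_piMr// ger0_norm ?box_bump_ge0//.
    exact: box_bump_le1.
  rewrite -[LHS]fineK; last exact: integrable_fin_num intm.
  congr (_%:E); have := f0 _ _ _ (s0 m) (subset_trans (bC m) CO).
  rewrite -(@Rintegral_support _ C) // => x.
  by rewrite mulf_eq0 negb_or => /andP[_ /(box_bump_neq0 (s0 m))].
rewrite -(setIidr hC) -[RHS]H integral_mkcondr; apply: eq_integral => x _.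
by rewrite patchE indicE; case: ifP; rewrite ?mulr1 ?mulr0.
Qed.

(** On each cube of the countable base, the sets over which the integral of [f] vanishes form a
    Dynkin system containing the boxes. It thus contains every measurable set, and [f] is null on
    the cube; countably many cubes cover [O]. *)
Lemma fundamental_lemma O f : open O -> locally_integrable_on O f ->
  (forall (s : R) a b, 0 < s -> cbox a b `<=` O ->
    \int[mu]_(x in cbox a b) (f x * box_bump s a b x) = 0) ->
  {ae mu, forall x, O x -> f x = 0}.
Proof.
move=> oO lf f0.
have cube p : rccube p 2 `<=` O -> {ae mu, forall x, rcube p 1 x -> f x = 0}.
  move=> pO.
  have mQ : measurable (rcube p (1 : R)) by exact: measurable_hbox.
  have QC : rcube p (1 : R) `<=` rccube p 2.
    move=> x px i; have := px i; rewrite !mxE => /andP[h1 h2].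
    have : 0 < p.2.+1%:R^-1 :> R by rewrite invr_gt0.
    by move: h1 h2; set r : R := _^-1 => h1 h2 r0; apply/andP; split; lra.
  have intQ : mu.-integrable (rcube p (1 : R)) (EFin \o f).
    apply: (integrableS (measurable_cbox _ _) mQ QC).
    by apply: lf pO; exact: cbox_compact.
  have box0 a b : (\int[mu]_(x in hbox a b `&` rcube p 1) (f x)%:E = 0)%E.
    (* The half-side of the cube serves as margin: enlarged by it, the cube still lies in its closed
       double. *)
    have r0 : 0 < p.2.+1%:R^-1 :> R by rewrite invr_gt0.
    rewrite /rcube hboxI; apply: (integral_hbox_eq0 lf f0 r0).
    apply: subset_trans pO => x h i; have := h i; rewrite !mxE ge_max.
    move=> /andP[/andP[_ h1] h2]; apply/andP; split.
      apply: le_trans h1; move: r0; set r : R := _^-1 => r0; lra.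
    apply: le_trans h2 _; rewrite -lerBrDr ge_min; apply/orP; right.
    by move: r0; set r : R := _^-1 => r0; lra.
  have all0 A : measurable A -> (\int[mu]_(x in A `&` rcube p 1) (f x)%:E = 0)%E.
    rewrite measurable_hboxesE.
    apply: (@dynkin_induction _ _ (@hboxes R n)
      (fun A => (\int[mu]_(x in A `&` rcube p 1) (f x)%:E = 0)%E)
      (@measurable_hboxesE R n) (@hboxes_setI R n)).
    - by rewrite setTI -(setIid (rcube p 1)); exact: box0.
    - by move=> _ [a [b ->]]; exact: box0.
    - move=> S mS S0.
      have Q0 : (\int[mu]_(x in rcube p 1) (f x)%:E = 0)%E.
        by rewrite -(setIid (rcube p 1)); exact: box0.
      have QE : S `&` rcube p 1 `|` ~` S `&` rcube p 1 = rcube p 1.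
        by rewrite -setIUl setUv setTI.
      have := @integral_setU _ _ _ mu (S `&` rcube p 1) (~` S `&` rcube p 1) (EFin \o f).
      rewrite QE Q0 S0 add0e => <- //.
      + exact: measurableI.
      + by apply: measurableI => //; exact: measurableC.
      + exact: measurable_int intQ.
      + by apply/disj_set2P; rewrite setIACA setICr set0I.
    - move=> F mF tF F0; rewrite setI_bigcupl integral_bigcup//.
      + by rewrite eseries0// => i _; exact: F0.
      + by apply: trivIset_setIr.
      + by move=> i; exact: measurableI.
      + rewrite -setI_bigcupl; apply: (integrableS mQ _ _ intQ) => //.
        by apply: measurableI => //; exact: bigcupT_measurable.
  have : ae_eq mu (rcube p 1) (EFin \o f) (cst 0%E).
    apply: integral_ae_eq => // E EQ mE; rewrite integral0.
    by rewrite -(setIidl EQ); exact: all0.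
  by apply: filterS => x h Qx; have [] := h Qx.
(* Enumeration of the exceptional sets of all cubes; an index that codes no cube, or a cube whose
   double leaves [O], contributes the empty set. *)
pose N k : set 'rV[R]_n := if unpickle k is Some p then
  [set x | [/\ rccube p 2 `<=` O, rcube p 1 x & f x <> 0]] else set0.
have N0 k : mu.-negligible (N k).
  rewrite /N; case: unpickle => [p|]; last exact: negligible_set0.
  have [pO|npO] := pselect (rccube p 2 `<=` O).
    by apply: negligibleS (cube _ pO) => x /= [_ px fx] /(_ px).
  by apply: (negligibleS _ (negligible_set0 _)) => x /= [].
apply: negligibleS (negligible_bigcup N0) => x /=.
rewrite {1}(open_rcube oO) => /not_implyP[[p pO px] fx].
by exists (pickle p) => //; rewrite /N pickleK.
Qed.

End fundamental_lemma.

(** * Integrability of products and translation invariance of integrals *)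

Lemma integrableM_bounded d (T : measurableType d) (R : realType)
    (m : {measure set T -> \bar R}) (D : set T) (f g : T -> R) (C : R) :
  measurable D -> m.-integrable D (EFin \o f) -> measurable_fun D g ->
  (forall x, D x -> `|g x| <= C) -> m.-integrable D (EFin \o (fun x => f x * g x)).
Proof.
move=> mD intf mg gC.
have mf : measurable_fun D f by apply/measurable_EFinP; exact: measurable_int intf.
apply: (@le_integrable _ _ _ m D mD _ (EFin \o (fun x => C * f x))).
- by apply/measurable_EFinP; exact: measurable_funM.
- move=> x Dx; rewrite /= lee_fin !normrM mulrC ler_wpM2r//.
  by rewrite (le_trans (gC _ Dx))// ler_norm.
- by rewrite (_ : _ \o _ = (fun x => C%:E * (f x)%:E)%E)//; exact: integrableZl.
Qed.

Lemma lebesgue_measure_shift (R : realType) (c : R) (A : set R) : measurable A ->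
  lebesgue_measure ((fun t : R => t + c) @^-1` A) = lebesgue_measure A.
Proof.
move=> mA.
have mc : measurable_fun setT ((fun t : R => t + c) : R -> measurableTypeR R).
  by apply: measurable_funD => //; exact: measurable_id.
pose nu := measure_function_pushforward__canonical__measure_function_Measure
  (@lebesgue_measure R) mc.
apply/esym; apply: (@lebesgue_measure_unique R nu) => // _ [[p q] _ <-].
rewrite /nu/= /pushforward.
have -> : (fun t : R => t + c) @^-1` `]p, q]%classic = `]p - c, q - c]%classic.
  by apply/seteqP; split => t; rewrite /= !in_itv/= ltrBlDr lerBrDr.
rewrite !lebesgue_measure_itv/= !lte_fin ltrD2r.
by case: ifP => // _; rewrite -!EFinB; congr (_%:E); ring.
Qed.

Lemma ge0_integral_shift1 (R : realType) (c : R) (f : R -> \bar R) :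
  measurable_fun setT f -> (forall x, 0 <= f x)%E ->
  (\int[lebesgue_measure]_t f (t + c)%R = \int[lebesgue_measure]_t f t)%E.
Proof.
move=> mf f0.
have mc : measurable_fun setT ((fun t : R => t + c) : R -> measurableTypeR R).
  by apply: measurable_funD => //; exact: measurable_id.
have := @ge0_integral_pushforward _ _ (measurableTypeR R) (measurableTypeR R) R _
  mc (@lebesgue_measure R) setT f measurableT mf (fun y _ => f0 y).
rewrite preimage_setT => <-; apply: eq_measure_integral => A mA _.
exact: lebesgue_measure_shift.
Qed.

Lemma integral_shift1 (R : realType) (c : R) (f : R -> \bar R) :
  measurable_fun setT f ->
  (\int[lebesgue_measure]_t f (t + c)%R = \int[lebesgue_measure]_t f t)%E.
Proof.
move=> mf; rewrite integralE [RHS]integralE; congr (_ - _)%E.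
  rewrite -[RHS](ge0_integral_shift1 c (measurable_funepos mf) (funepos_ge0 f)).
  by apply: eq_integral => t _; rewrite !funeposE.
rewrite -[RHS](ge0_integral_shift1 c (measurable_funeneg mf) (funeneg_ge0 f)).
by apply: eq_integral => t _; rewrite !funenegE.
Qed.

Section shift.
Context (R : realType) (n : nat).
Implicit Types (v x : 'rV[R]_n).
Local Notation mu := (lebesgue_rV R n).

Lemma ge0_integral_shift v (f : 'rV[R]_n -> \bar R) :
  measurable_fun setT f -> (forall x, 0 <= f x)%E ->
  (\int[mu]_x f (x + v)%R = \int[mu]_x f x)%E.
Proof.
move=> mf f0.
have := ge0_integral_pushforward (measurable_shift_rV v) mu measurableT mf
  (fun y _ => f0 y).
rewrite preimage_setT => <-; apply: eq_measure_integral.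
  exact: measurable_shift_rV.
by move=> msh A mA _; exact: lebesgue_rV_shift.
Qed.

Lemma integral_shift v (f : 'rV[R]_n -> \bar R) : measurable_fun setT f ->
  (\int[mu]_x f (x + v)%R = \int[mu]_x f x)%E.
Proof.
move=> mf; rewrite integralE [RHS]integralE; congr (_ - _)%E.
  rewrite -[RHS](ge0_integral_shift v (measurable_funepos mf) (funepos_ge0 f)).
  by apply: eq_integral => t _; rewrite !funeposE.
rewrite -[RHS](ge0_integral_shift v (measurable_funeneg mf) (funeneg_ge0 f)).
by apply: eq_integral => t _; rewrite !funenegE.
Qed.

Lemma measurable_comp_shift d (T : measurableType d) v (f : 'rV[R]_n -> T) :
  measurable_fun setT f -> measurable_fun setT (fun x => f (x + v)).
Proof. by move=> mf; apply: (measurableT_comp mf); exact: measurable_shift_rV. Qed.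

Lemma integrable_shift v (f : 'rV[R]_n -> R) : mu.-integrable setT (EFin \o f) ->
  mu.-integrable setT (EFin \o (fun x => f (x + v))).
Proof.
move=> /integrableP[mf foo]; apply/integrableP; split.
  exact: (measurable_comp_shift v mf).
rewrite [ltLHS](ge0_integral_shift v (f := fun x => `|(f x)%:E|%E))//.
by apply: measurableT_comp.
Qed.

Lemma Rintegral_shift v (f : 'rV[R]_n -> R) : measurable_fun setT f ->
  \int[mu]_x f (x + v) = \int[mu]_x f x.
Proof.
move=> mf; congr fine; apply: (integral_shift v (f := EFin \o f)).
exact/measurable_EFinP.
Qed.

End shift.

(** * Averages along a coordinate direction *)

Section average.
Context (R : realType) (n : nat) (i : 'I_n).
Local Notation mu := (lebesgue_rV R n).
Local Notation leb := (@lebesgue_measure R).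
Local Notation e := (delta_mx 0 i : 'rV[R]_n).

(** Not divided by [h]: in this normalisation it equals the increment of a function with derivative
    [g] along the segment. *)
Definition average (g : 'rV[R]_n -> R) (h : R) (x : 'rV[R]_n) : R :=
  \int[leb]_(t in `[0, h]) g (x + t *: e).

(** The factor [s] is later 0, 1 or -1, so that integrands at x, x + t e and x - t e are handled
    uniformly. *)
Lemma measurable_line_shift (s : R) : measurable_fun setT
  ((fun p => p.1 + (s * p.2) *: e) : 'rV[R]_n * R -> 'rV[R]_n).
Proof.
apply: measurable_fun_rV => j.
under eq_fun do rewrite !mxE.
apply: measurable_funD => /=.
  exact: (measurableT_comp (measurable_coord j) measurable_fst).
apply: measurable_funM => //=; apply: measurable_funM => //=.
Qed.

Lemma measurable_line x : measurable_fun setT (fun t : R => x + t *: e).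
Proof.
apply: measurable_fun_rV => j.
under eq_fun do rewrite !mxE.
apply: measurable_funD => //; apply: measurable_funM => //.
Qed.

(** For fixed t the integral of |f| over x is unaffected by the translation, so the double integral
    is the L^1 norm of [f] times the length of the segment. *)
Lemma fubini_integrable1 (f : 'rV[R]_n -> R) (h s : R) :
  mu.-integrable setT (EFin \o f) ->
  (mu \x leb)%E.-integrable setT
    (EFin \o (fun p => f (p.1 + (s * p.2) *: e) * \1_`[0, h] p.2)).
Proof.
move=> /integrableP[/measurable_EFinP mf foo].
have m1 : measurable_fun setT (fun p : 'rV[R]_n * R => f (p.1 + (s * p.2) *: e)).
  exact: (measurableT_comp mf (measurable_line_shift s)).
have m3 : measurable_fun setT (fun p : 'rV[R]_n * R => \1_`[0, h] p.2 : R).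
  by apply: (measurableT_comp _ measurable_snd); exact: measurable_indic.
apply/integrable21ltyP.
  by apply/measurable_EFinP; exact: measurable_funM.
have K0 : (0 <= \int[mu]_x `|(f x)%:E|)%E by exact: integral_ge0.
have Kfin : (\int[mu]_x `|(f x)%:E|)%E \is a fin_num by rewrite ge0_fin_numE.
set L := (X in (X < _)%E).
have -> : L = (\int[leb]_t ((\1_`[0, h] t)%:E * \int[mu]_x `|(f x)%:E|))%E.
  apply: eq_integral => t _.
  have mshift : measurable_fun setT (fun x : 'rV[R]_n => `|(f (x + (s * t) *: e))%:E|%E).
    apply: measurableT_comp => //; apply/measurable_EFinP.
    exact: (measurable_comp_shift _ mf).
  rewrite -(ge0_integral_shift ((s * t) *: e) (f := fun x => `|(f x)%:E|%E))//; last first.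
    by apply: measurableT_comp => //; exact/measurable_EFinP.
  rewrite -ge0_integralZl//.
  apply: eq_integral => x _; rewrite /= normrM EFinM muleC; congr (_%:E * _)%E.
  by rewrite ger0_norm// indicE.
rewrite -(fineK Kfin) ge0_integralZr//=; last 2 first.
- by apply/measurable_EFinP; exact: measurable_indic.
- by rewrite lee_fin fine_ge0.
rewrite integral_indic// setIT [X in (X * _)%E]lebesgue_measure_itv/=.
by case: ifP => _; rewrite ?mul0e// -EFinB -EFinM ltry.
Qed.

Lemma fubini_integrable (f phi : 'rV[R]_n -> R) (h C s1 s2 : R) :
  mu.-integrable setT (EFin \o f) -> measurable_fun setT phi ->
  (forall x, `|phi x| <= C) ->
  (mu \x leb)%E.-integrable setT
    (EFin \o (fun p => f (p.1 + (s1 * p.2) *: e) * \1_`[0, h] p.2 *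
       phi (p.1 + (s2 * p.2) *: e))).
Proof.
move=> intf mphi phiC; apply: integrableM_bounded.
- exact: measurableT.
- exact: fubini_integrable1.
- exact: (measurableT_comp mphi (measurable_line_shift s2)).
- by move=> p _; exact: phiC.
Qed.

Lemma bounded_itv_integral (f : R -> R) (h M : R) : 0 <= h ->
  measurable_fun setT f -> (forall t, `|f t| <= M) ->
  [/\ leb.-integrable `[0, h] (EFin \o f),
      `|\int[leb]_(t in `[0, h]) f t| <= M * h &
      (\int[leb]_(t in `[0%R, h]) f t)%:E =
        (\int[leb]_t (f t * \1_`[0%R, h] t)%:E)%E].
Proof.
move=> h0 mf fM.
have hE : leb `[0, h]%classic = h%:E.
  rewrite lebesgue_measure_itv/= lte_fin; case: ltgtP h0 => // [_ _|<- _] //.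
  by rewrite -EFinB subr0.
have hfin : (leb `[0%R, h]%classic < +oo)%E by rewrite hE ltry.
have ib (g : R -> R) : measurable_fun setT g -> (forall t, `|g t| <= M) ->
    leb.-integrable `[0, h] (EFin \o g).
  move=> mg gM; apply: (@measurable_bounded_integrable _ _ _ leb) => //.
  - exact: measurable_funS mg.
  - exists M; split; first exact: num_real.
    by move=> y My t _; apply: le_trans (gM _) _; exact: ltW.
have M0 : 0 <= M := le_trans (normr_ge0 _) (fM 0).
have intM : leb.-integrable `[0, h] (EFin \o (fun _ : R => M)).
  by apply: ib => // t; rewrite ger0_norm.
have intf := ib _ mf fM; split => //.
  apply: le_trans (le_normr_Rintegral _ intf) _ => //.
  apply: (@le_trans _ _ (\int[leb]_(t in `[0, h]) M)).
    by apply: le_Rintegral => //; apply: (integrable_norm intf).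
  rewrite Rintegral_cst// [fine _](_ : _ = h)//.
  exact: (congr1 fine hE).
rewrite fineK; last exact: integrable_fin_num intf.
rewrite integral_mkcond; apply: eq_integral => t _.
by rewrite patchE indicE; case: ifP => _; rewrite ?mulr1 ?mulr0.
Qed.

(** Averaging along e has averaging along -e as its transpose: exchange the integrals, translate x
    by - t e for each fixed t, and exchange back. *)
Lemma Rintegral_average (g phi : 'rV[R]_n -> R) (h C M : R) : 0 <= h ->
  mu.-integrable setT (EFin \o g) -> (forall x, `|g x| <= M) ->
  measurable_fun setT phi -> (forall x, `|phi x| <= C) ->
  [/\ measurable_fun setT (average g h),
      mu.-integrable setT (EFin \o average g h) &
  \int[mu]_x (average g h x * phi x) =
  \int[mu]_x (g x * \int[leb]_(t in `[0, h]) phi (x - t *: e))].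
Proof.
move=> h0 intg gM mphi phiC.
have mg : measurable_fun setT g by apply/measurable_EFinP; exact: measurable_int intg.
have I0 := fubini_integrable1 h 1 intg.
have mgx x : measurable_fun setT (fun t : R => g (x + t *: e)).
  exact: (measurableT_comp mg (measurable_line x)).
have avE x : (average g h x)%:E =
    fubini_F leb (EFin \o (fun p => g (p.1 + (1 * p.2) *: e) * \1_`[0, h] p.2)) x.
  have [_ _] := bounded_itv_integral h0 (mgx x) (fun t => gM (x + t *: e)).
  rewrite /fubini_F /average => ->; apply: eq_integral => t _ /=.
  by rewrite mul1r.
split.
- apply/measurable_EFinP; rewrite (funext avE : EFin \o average g h = _).
  exact: (measurable_fubini_F I0).
- rewrite (funext avE : EFin \o average g h = _); exact: (integrable_fubini_F I0).
have I1 := fubini_integrable h 1 0 intg mphi phiC.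
have I2 := fubini_integrable h 0 (-1) intg mphi phiC.
rewrite /Rintegral; congr fine.
transitivity (\int[mu]_x \int[leb]_t
    (EFin \o (fun p => g (p.1 + (1 * p.2) *: e) * \1_`[0%R, h] p.2 *
       phi (p.1 + (0 * p.2) *: e))%R) (x, t))%E.
  apply: eq_integral => x _; rewrite /average -RintegralZr//; last first.
    by have [] := bounded_itv_integral h0 (mgx x) (fun t => gM (x + t *: e)).
  have [||_ _ ->] := @bounded_itv_integral (fun t => g (x + t *: e) * phi x) h (M * C) h0.
  - by apply: measurable_funM => //.
  - by move=> t; rewrite normrM ler_pM.
  apply: eq_integral => t _ /=.
  by rewrite mul1r mul0r scale0r addr0 mulrAC.
rewrite Fubini//.
transitivity (\int[leb]_t \int[mu]_x
    (EFin \o (fun p => g (p.1 + (0 * p.2) *: e) * \1_`[0%R, h] p.2 *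
       phi (p.1 + (- 1 * p.2) *: e))%R) (x, t))%E.
  apply: eq_integral => t _ /=.
  rewrite -[RHS](integral_shift (t *: e)); last first.
    apply/measurable_EFinP; apply: measurable_funM.
      by apply: measurable_funM => //; exact: measurable_comp_shift.
    exact: measurable_comp_shift.
  apply: eq_integral => x _; congr (_%:E); rewrite mul1r !mul0r !scale0r !addr0.
  by rewrite mulN1r scaleNr addrK.
rewrite -Fubini//; apply: eq_integral => x _ /=.
have mphix : measurable_fun setT (fun t : R => phi (x - t *: e)).
  apply: (measurableT_comp mphi); apply: measurable_fun_rV => j.
  under eq_fun do rewrite !mxE -mulNr.
  by apply: measurable_funD => //; apply: measurable_funM.
rewrite -RintegralZl//; last first.
  by have [] := bounded_itv_integral h0 mphix (fun t => phiC (x - t *: e)).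
have [||_ _ ->] := @bounded_itv_integral (fun t => g x * phi (x - t *: e)) h (M * C) h0.
- exact: measurable_funM.
- by move=> t; rewrite normrM ler_pM.
apply: eq_integral => t _ /=.
by rewrite mulN1r scaleNr mul0r scale0r addr0 mulrAC.
Qed.

(** On a single line [g] is a bounded measurable function of one variable, and its primitive has
    derivative [g] at almost every parameter. *)
Lemma lebesgue_pt_average (g : 'rV[R]_n -> R) (M : R) (u : R^nat) (x : 'rV[R]_n) :
  measurable_fun setT g -> (forall x, `|g x| <= M) ->
  (forall m, 0 < u m) -> u m @[m --> \oo] --> (0 : R) ->
  {ae leb, forall t, t \in `[0, 1] ->
     average g (u m) (x + t *: e) / u m @[m --> \oo] --> g (x + t *: e)}.
Proof.
move=> mg gM u0 uc; pose G (t : R) := g (x + t *: e).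
have mG : measurable_fun setT G by exact: (measurableT_comp mg (measurable_line x)).
(* The primitive starts at -1 so that every t in [0, 1], including 0, lies strictly to the right of
   its base point. *)
have intG (y : R) : leb.-integrable [set` Interval (BLeft (- 1 : R)) (BRight y)] (EFin \o G).
  apply: (@measurable_bounded_integrable _ _ _ leb) => //.
  - rewrite [X in (X < _)%E]lebesgue_measure_itv/=.
    by case: ifP => _ //; rewrite -EFinB ltry.
  - exact: measurable_funS mG.
  - exists M; split; first exact: num_real.
    by move=> z Mz t _; apply: le_trans (gM _) _; exact: ltW.
have locG : locally_integrable [set: R] G.
  split => //; first exact: openT.
  move=> K _ cK.
  have intK : leb.-integrable K (EFin \o G).
    apply: (@measurable_bounded_integrable _ _ _ leb) => //.
    - exact: compact_measurable.
    - exact: compact_finite_measure.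
    - exact: measurable_funS mG.
    - exists M; split; first exact: num_real.
      by move=> z Mz t _; apply: le_trans (gM _) _; exact: ltW.
  by have /integrableP[] := intK.
have := FTC1 intG locG; apply: filterS; first exact: (ae_filter_ringOfSetsType leb).
move=> t + t01.
move: t01; rewrite in_itv/= => /andP[t0 t1].
have lt1 : ((- 1)%:E < t%:E :> \bar R)%E by rewrite lte_fin; lra.
move=> /(_ lt1); set F := (fun x => _) => -[dF FE].
have avE m : average g (u m) (x + t *: e) = F (t + u m) - F t.
  have tu : t <= t + u m by rewrite lerDl ltW.
  rewrite (Rintegral_itvB (intG _))//; last by rewrite bnd_simp; lra.
  rewrite Rintegral_itv_obnd_cbnd; last first.
    apply: integrableS (intG (t + u m)) => //.
    by apply: subset_itvr; rewrite bnd_simp; exact: ltW.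
  rewrite /average Rintegral_mkcond [RHS]Rintegral_mkcond; congr fine.
  rewrite -[RHS](integral_shift1 t); last first.
    apply/measurable_EFinP.
    apply: (measurable_restrictT _ (measurable_itv `[t, t + u m])).1.
    exact: measurable_funS mG.
  apply: eq_integral => s _; rewrite !patchE; congr (_%:E).
  rewrite /G -addrA -scalerDl (addrC t s).
  rewrite (_ : (s \in `[0, u m]%classic) = (s + t \in `[t, t + u m]%classic))//.
  apply: asbool_equiv_eq => /=; rewrite !in_itv/= lerDr (addrC s) lerD2l.
  by [].
have cF : h^-1 *: (F (h *: (1 : R) + t) - F t) @[h --> 0^'] --> G t.
  by rewrite -FE derive1E; exact: dF.
have := (cvgr_dnbhsP _ _ _).1 cF u (conj (fun m => lt0r_neq0 (u0 m)) uc).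
apply: cvg_trans; apply: near_eq_cvg; apply: nearW => m /=.
by rewrite avE [_ *: (1 : R)]mulr1 [_ *: _]mulrC (addrC t).
Qed.

(* The exceptional set N has null trace on every line in direction i by
   [lebesgue_pt_average]; averaging the measure of N over translations by t e_i,
   t in [0, 1], then shows that N is null. *)
Lemma average_cvg (g : 'rV[R]_n -> R) (M : R) (u : R^nat) :
  mu.-integrable setT (EFin \o g) -> (forall x, `|g x| <= M) ->
  (forall m, 0 < u m) -> u m @[m --> \oo] --> (0 : R) ->
  {ae mu, forall x, average g (u m) x / u m @[m --> \oo] --> g x}.
Proof.
move=> intg gM u0 uc.
have mg : measurable_fun setT g by apply/measurable_EFinP; exact: measurable_int intg.
pose d m x := `|average g (u m) x / u m - g x|.
(* Convergence at x means that this upper limit is 0; expressed in this way, the exceptional set is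
   measurable and Tonelli applies to it. *)
pose L x := limn_esup (fun m => (d m x)%:E).
have mav m : measurable_fun setT (average g (u m)).
  have [] // := @Rintegral_average g (cst 0) (u m) 0 M (ltW (u0 m)) intg gM.
  by move=> x; rewrite normr0.
have mL : measurable_fun setT L.
  apply: measurable_fun_limn_esup => m; apply/measurable_EFinP.
  apply: measurableT_comp => //; apply: measurable_funB => //.
  exact: measurable_funM.
pose N := ~` (L @^-1` [set 0%E]).
have mN : measurable N.
  by apply: measurableC; rewrite -[X in measurable X]setTI; exact: mL.
have Ncvg x : ~ N x -> average g (u m) x / u m @[m --> \oo] --> g x.
  move=> /contrapT Lx; apply/cvgrPdist_lt => r r0.
  have : (d m x)%:E @[m --> \oo] --> 0%E.
    apply: limn_esup_le_cvg => [|m]; first by rewrite -/(L x) Lx.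
    by rewrite lee_fin /d.
  move=> /fine_cvgP[_ /cvgr0_norm_lt/(_ r r0)]; apply: filterS => m /=.
  by rewrite normr_id distrC.
have cvgN x : average g (u m) x / u m @[m --> \oo] --> g x -> ~ N x.
  move=> cx; apply; rewrite /= /L.
  have cd : (d m x)%:E @[m --> \oo] --> 0%E.
    apply: cvg_EFin; first exact: nearW.
    rewrite -[X in _ --> X](@normr0 _ R) -(subrr (g x)); apply: cvg_norm.
    by apply: cvgB => //; exact: cvg_cst.
  by rewrite (cvg_limn_einf_sup cd).2.
suff : mu N = 0%E.
  move=> N0; exists N; split => // x /= nx; apply: contrapT => /Ncvg.
  exact: nx.
pose f (p : 'rV[R]_n * R) : \bar R := (\1_N (p.1 + (1 * p.2) *: e) * \1_`[0, 1] p.2)%:E.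
have mf : measurable_fun setT f.
  apply/measurable_EFinP; apply: measurable_funM.
    apply: (measurableT_comp _ (measurable_line_shift 1)).
    exact: measurable_indic.
  by apply: (measurableT_comp _ measurable_snd); exact: measurable_indic.
have f0 p : (0 <= f p)%E by rewrite lee_fin mulr_ge0// indicE.
have := @fubini_tonelli _ _ _ _ _ mu leb f mf f0; rewrite /fubini_F /fubini_G.
have -> : (\int[mu]_x \int[leb]_t f (x, t) = 0)%E.
  rewrite integral0_eq// => x _.
  rewrite -[RHS](integral0 leb setT); apply: ae_eq_integral => //.
    apply/measurable_EFinP; apply: measurable_funM => /=.
      rewrite (_ : (fun _ => _) = (\1_N : _ -> R) \o (fun t : R => x + t *: e)).
        by apply: (measurableT_comp _ (measurable_line x)); exact: measurable_indic.
      by apply/funext => t; rewrite /= mul1r.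
    exact: measurable_indic.
  have := lebesgue_pt_average x mg gM u0 uc.
  apply: filterS; first exact: (ae_filter_ringOfSetsType leb).
  move=> t + _; rewrite /f /= mul1r => H.
  have [t01|t01] := boolP (t \in `[0, 1]%classic); last first.
    by rewrite [X in _ * X]indicE (negbTE t01) mulr0.
  rewrite indicE memNset ?mul0r//; apply: cvgN; apply: H.
  by move: t01; rewrite inE.
have -> : (\int[leb]_t \int[mu]_x f (x, t) = mu N)%E.
  have E t : (\int[mu]_x f (x, t) = mu N * (\1_`[0%R, 1%R] t)%:E)%E.
    have m1N : measurable_fun setT (fun x => (\1_N x : R)%:E).
      by apply/measurable_EFinP; exact: measurable_indic.
    transitivity (\int[mu]_x ((\1_N x)%:E * (\1_`[0%R, 1%R] t)%:E))%E.
      rewrite -[RHS](integral_shift (t *: e)); last exact: emeasurable_funM.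
      by apply: eq_integral => x _; rewrite /f/= mul1r EFinM.
    have t0 : (0 <= (\1_`[0%R, 1%R] t : R)%:E)%E by rewrite lee_fin indicE.
    by rewrite ge0_integralZr// integral_indic// setIT.
  transitivity (\int[leb]_t (mu N * (\1_`[0%R, 1%R] t)%:E))%E.
    by apply: eq_integral => t _; exact: E.
  rewrite ge0_integralZl//; last first.
    by apply/measurable_EFinP; exact: measurable_indic.
  rewrite integral_indic// setIT [X in (_ * X)%E]lebesgue_measure_itv/= lte_fin ltr01.
  by rewrite -EFinB subr0 mule1.
by move/esym.
Qed.


End average.

(** * Increments of weakly differentiable functions *)

Section difference_quotient.
Context (R : realType) (n : nat) (i : 'I_n).
Local Notation mu := (lebesgue_rV R n).
Local Notation leb := (@lebesgue_measure R).
Local Notation e := (delta_mx 0 i : 'rV[R]_n).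

(** For the averaged bump [psi] of [step_function], the weak identity contains bump(x) - bump(x - h
    e) on the side of [u] and a backward average of the bump on the side of [g]. Moving translation
    and average onto [u] and [g] shows that the difference of the two sides is orthogonal to every
    box bump in [O]. *)
Lemma difference_average (D O : set 'rV[R]_n) (u g : 'rV[R]_n -> R) (h M : R) :
  0 < h -> open O ->
  (forall x t, O x -> 0 <= t <= h -> D (x + t *: e)) ->
  mu.-integrable setT (EFin \o u) -> mu.-integrable setT (EFin \o g) ->
  (forall x, `|g x| <= M) ->
  (forall psi, test_function D psi ->
    \int[mu]_x (u x * partial i psi x) = - \int[mu]_x (g x * psi x)) ->
  {ae mu, forall x, O x -> u (x + h *: e) - u x = average i g h x}.
Proof.
move=> h0 oO OD intu intg gM ug.
have mu_ : measurable_fun setT u by apply/measurable_EFinP; exact: measurable_int intu.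
have mg : measurable_fun setT g by apply/measurable_EFinP; exact: measurable_int intg.
pose f x := u (x + h *: e) - u x - average i g h x.
have b1 s a b x : `|box_bump s a b x| <= 1.
  by rewrite ger0_norm ?box_bump_ge0// box_bump_le1.
have mb s a b : measurable_fun setT (box_bump s a b : 'rV[R]_n -> R).
  by apply: continuous_measurable_rV; exact: continuous_box_bump.
have [mav intav _] := Rintegral_average i (ltW h0) intg gM
  (mb 1 0 0) (b1 _ _ 1 0 0).
have intf : mu.-integrable setT (EFin \o f).
  have i1 : mu.-integrable setT (EFin \o (fun x => u (x + h *: e) - u x)).
    exact: (integrableB measurableT (integrable_shift (h *: e) intu) intu).
  exact: (integrableB measurableT i1 intav).
suff : {ae mu, forall x, O x -> f x = 0}.
  by apply: filterS => x + Ox => /(_ Ox)/eqP; rewrite subr_eq0 => /eqP.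
apply: fundamental_lemma => //.
  move=> K cK _; apply: integrableS intf => //.
  exact: compact_measurable_rV.
move=> s a b s0 abO.
have [ab|] := pselect (forall j, a 0 j <= b 0 j); last first.
  move=> /existsNP[j /negP]; rewrite -ltNge => ba.
  rewrite (_ : cbox a b = set0) ?Rintegral_set0//.
  apply/seteqP; split => // x /(_ j) /andP[ax xb].
  by have := le_trans ax xb; rewrite leNgt ba.
have abD : cbox a (b + h *: e) `<=` D.
  (* The excess of coordinate i over b_i: subtracting t e brings the point back into the box because
     a_i <= b_i. *)
  move=> y yab; pose t := Num.max 0 (y 0 i - b 0 i).
  have th : 0 <= t <= h.
    rewrite le_max lexx/= ge_max (ltW h0)/= lerBlDl.
    by have /andP[_] := yab i; rewrite !mxE !eqxx/= mulr1.
  rewrite -(subrK (t *: e) y); apply: OD => //; apply: abO => j.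
  have := yab j; rewrite !mxE eqxx/=; have [->|ji] /= := eqVneq j i.
    rewrite !mulr1 => /andP[h1 h2]; have := ab i; rewrite /t.
    by case: (leP 0 (y 0 i - b 0 i)) => h3 h4; apply/andP; split; lra.
  by rewrite !mulr0 subr0 addr0.
have [psi [tpsi dpsi psiE]] := step_function s0 h0 abD.
have H := ug _ tpsi.
rewrite -(@Rintegral_support _ _ _ setT) //; last first.
  by move=> x; rewrite mulf_eq0 negb_or => /andP[_ /(box_bump_neq0 s0)].
have intub : mu.-integrable setT (EFin \o (fun x => u x * box_bump s a b x)).
  by apply: (integrableM_bounded measurableT intu (mb s a b) (C := 1)) => x _.
have intubh : mu.-integrable setT (EFin \o (fun x => u (x + h *: e) * box_bump s a b x)).
  by apply: (integrableM_bounded measurableT (integrable_shift _ intu) (mb s a b) (C := 1)) => x _.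
have intab : mu.-integrable setT (EFin \o (fun x => average i g h x * box_bump s a b x)).
  by apply: (integrableM_bounded measurableT intav (mb s a b) (C := 1)) => x _.
have intubh' : mu.-integrable setT (EFin \o (fun x => u x * box_bump s a b (x - h *: e))).
  apply: (integrableM_bounded measurableT intu _ (C := 1)) => [|x _] //.
  exact: (measurable_comp_shift (- (h *: e)) (mb s a b)).
have E1 : \int[mu]_x (u x * partial i psi x) =
    \int[mu]_x (u x * box_bump s a b x) - \int[mu]_x (u (x + h *: e) * box_bump s a b x).
  have -> : \int[mu]_x (u (x + h *: e) * box_bump s a b x) =
            \int[mu]_x (u x * box_bump s a b (x - h *: e)).
    rewrite -[RHS](Rintegral_shift (h *: e)).
      by apply: eq_Rintegral => x _; rewrite addrK.
    by apply/measurable_EFinP; exact: measurable_int intubh'.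
  rewrite -RintegralB//; apply: eq_Rintegral => x _.
  by rewrite dpsi mulrBr.
have E2 : \int[mu]_x (g x * psi x) = \int[mu]_x (average i g h x * box_bump s a b x).
  have [_ _ ->] := Rintegral_average i (ltW h0) intg gM (mb s a b) (b1 _ _ s a b).
  by apply: eq_Rintegral => x _; rewrite psiE.
rewrite (_ : (fun x => _) = (fun x => u (x + h *: e) * box_bump s a b x -
    u x * box_bump s a b x - average i g h x * box_bump s a b x)); last first.
  by apply/funext => x; rewrite /f !mulrBl.
rewrite RintegralB//; last exact: (integrableB measurableT intubh intub).
by rewrite RintegralB// -E2; move: H; rewrite E1; lra.
Qed.

End difference_quotient.

(** * Chain rule for the positive part *)

Section huber.
Context (R : realType).
Implicit Types (eps s t : R).

Definition pospart (s : R) : R := Num.max s 0.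

(* s ^+ 2 / (2 eps) on [0, eps] and s - eps / 2 beyond. *)
Definition huber eps s : R := (pospart s ^+ 2 - pospart (s - eps) ^+ 2) / (2 * eps).
(** The derivative of [huber eps], that is, s / eps clipped to [0, 1]. *)
Definition dhuber eps s : R := (pospart s - pospart (s - eps)) / eps.

Lemma pospartE s : pospart s = if 0 <= s then s else 0.
Proof. by rewrite /pospart; case: leP. Qed.

Lemma huber_lipschitz eps s t : 0 < eps -> `|huber eps t - huber eps s| <= `|t - s|.
Proof.
move=> e0; have e2 : 0 < 2 * eps by rewrite mulr_gt0.
wlog st : s t / s <= t.
  move=> H; have [/H//|/ltW/H] := leP s t.
  by rewrite distrC (distrC s).
rewrite (ger0_norm (_ : 0 <= t - s)) ?subr_ge0//.
rewrite /huber -mulrBl normrM normfV (gtr0_norm e2).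
rewrite ler_pdivrMr// ler_norml !pospartE.
by apply/andP; case: (leP 0 s) => ?; case: (leP 0 t) => ?;
  case: (leP 0 (s - eps)) => ?; case: (leP 0 (t - eps)) => ?; split; nra.
Qed.

Lemma huber_pos eps s : 0 < eps -> `|huber eps s - pospart s| <= eps.
Proof.
move=> e0; have e2 : 0 < 2 * eps by rewrite mulr_gt0.
have -> : huber eps s - pospart s =
    (pospart s ^+ 2 - pospart (s - eps) ^+ 2 - 2 * eps * pospart s) / (2 * eps).
  by rewrite /huber; field; rewrite lt0r_neq0.
rewrite normrM normfV (gtr0_norm e2).
rewrite ler_pdivrMr// ler_norml !pospartE.
by apply/andP; case: (leP 0 s) => ?; case: (leP 0 (s - eps)) => ?; split; nra.
Qed.

(** The first-order remainder of the squared positive part lies between 0 and the squared increment.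
    The remainder here is the difference of two such quantities with the same increment, divided by
    2 eps. *)
Lemma huber_quadratic eps s t : 0 < eps ->
  `|huber eps t - huber eps s - dhuber eps s * (t - s)| <= (t - s) ^+ 2 / (2 * eps).
Proof.
move=> e0; have e2 : 0 < 2 * eps by rewrite mulr_gt0.
have -> : huber eps t - huber eps s - dhuber eps s * (t - s) =
    ((pospart t ^+ 2 - pospart s ^+ 2 - 2 * pospart s * (t - s)) -
     (pospart (t - eps) ^+ 2 - pospart (s - eps) ^+ 2 -
      2 * pospart (s - eps) * (t - s))) / (2 * eps).
  by rewrite /huber /dhuber; field; rewrite lt0r_neq0.
rewrite normrM normfV (gtr0_norm e2).
rewrite ler_pM2r ?invr_gt0//.
have q a b : 0 <= pospart b ^+ 2 - pospart a ^+ 2 - 2 * pospart a * (b - a) <= (b - a) ^+ 2.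
  have s1 := sqr_ge0 (b - a); have s2 := sqr_ge0 a; have s3 := sqr_ge0 b.
  by rewrite !pospartE; apply/andP; case: (leP 0 a) => ?; case: (leP 0 b) => ?; split; nra.
have /andP[q1 q2] := q s t; have /andP[] := q (s - eps) (t - eps).
rewrite (_ : t - eps - (s - eps) = t - s); last by ring.
move=> q3 q4; rewrite ler_norml; apply/andP; split; lra.
Qed.

Lemma huber0 eps : 0 < eps -> huber eps 0 = 0.
Proof.
move=> e0; rewrite /huber !pospartE lexx sub0r oppr_ge0 leNgt e0/=.
by rewrite expr0n subrr mul0r.
Qed.

Lemma cvg_huber s : huber (harmonic m) s @[m --> \oo] --> pospart s.
Proof.
apply/cvgrPdist_le => r r0; have := @cvg_harmonic R => /cvgr0_norm_le/(_ r r0).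
apply: filterS => m hm; rewrite distrC (le_trans (huber_pos _ _)) ?invr_gt0//.
exact: le_trans (ler_norm _) hm.
Qed.

(** At s = 0 all terms vanish, so the limit is the indicator of the open half-line; this fixes the
    derivative of the positive part to be 0 on the zero set. *)
Lemma cvg_dhuber s : dhuber (harmonic m) s @[m --> \oo] --> (if 0 < s then 1 else 0 : R).
Proof.
case: ltP => s0.
  apply: cvg_near_cst; have := @cvg_harmonic R => /cvgr0_norm_le/(_ s s0).
  apply: filterS => m; rewrite ger0_norm; last by rewrite invr_ge0.
  move=> hm; rewrite /dhuber !pospartE (ltW s0) subr_ge0 hm opprB addrC subrK divff//.
  by rewrite invr_neq0.
apply: cvg_near_cst; apply: nearW => m; rewrite /dhuber.
have h0 : 0 < harmonic m :> R by rewrite invr_gt0.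
have -> : pospart s = 0 by rewrite /pospart max_r.
have -> : pospart (s - harmonic m) = 0 by rewrite /pospart max_r//; lra.
by rewrite subrr mul0r.
Qed.

Lemma measurable_pospart : measurable_fun setT pospart.
Proof. by apply: measurable_maxr. Qed.

Lemma measurable_huber eps : measurable_fun setT (huber eps).
Proof.
apply: measurable_funM => //; apply: measurable_funB; apply: measurable_funX.
  exact: measurable_pospart.
by apply: (measurableT_comp measurable_pospart); exact: measurable_funB.
Qed.

End huber.

(** * Supports and difference quotients of test functions *)

Section support.
Context (R : realType) (n : nat) (i : 'I_n).
Implicit Types (x : 'rV[R]_n) (K D : set 'rV[R]_n) (phi : 'rV[R]_n -> R).
Local Notation mu := (lebesgue_rV R n).
Local Notation e := (delta_mx 0 i : 'rV[R]_n).

Lemma partial_support phi x : partial i phi x != 0 ->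
  closure [set x | phi x != 0] x.
Proof.
move=> px; apply: contrapT => nx.
have oC : open (~` closure [set x | phi x != 0]).
  by apply: closed_openC; exact: closed_closure.
suff : is_derive x e phi 0 by case=> _ p0; move: px; rewrite /partial p0 eqxx.
apply: (@near_eq_is_derive _ _ _ (cst 0)).
have := oC x nx; apply: filterS => y ny; apply/esym/eqP.
by apply: contrapT => /negP py; apply: ny; exact: subset_closure.
Qed.

Lemma compact_thickening K D : compact K -> open D -> K `<=` D ->
  exists2 r : R, 0 < r & forall x y, K x -> `|y - x| <= r -> D y.
Proof.
move=> cK oD KD.
have H : \forall r \near (0 : R)^'+, K `<=` [set x | forall y, `|y - x| <= r -> D y].
  apply: ((compact_near_coveringP K).1 cK) => x Kx.
  have := oD x (KD x Kx); rewrite -nbhs_ballE => -[d d0 dD].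
  exists (ball x (d / 2), [set r : R | r <= d / 2]).
    split; first by apply: nbhsx_ballx; rewrite divr_gt0.
    by apply: nbhs_right_le; rewrite divr_gt0.
  move=> [z r] /= [xz rd] y yz; apply: dD; move: xz.
  rewrite mx_norm_ball /ball_/= => xz.
  rewrite (splitr d) distrC -(subrK z y) -addrA (le_lt_trans (ler_normD _ _))//.
  by rewrite ler_ltD ?(le_trans yz)// distrC.
near (0 : R)^'+ => r; exists r => //.
by move=> x y Kx; apply: (near H r).
Unshelve. all: by end_near. Qed.

Definition thickening K (r : R) : set 'rV[R]_n :=
  [set y | exists2 x, K x & `|y - x| <= r].

Lemma thickening_compact K r : 0 <= r -> compact K -> compact (thickening K r).
Proof.
move=> r0 cK; rewrite (_ : thickening K r =
    (fun p => p.1 + p.2) @` (K `*` cbox (const_mx (- r)) (const_mx r))).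
  apply: continuous_compact.
    apply: continuous_subspaceT => p.
    by apply: cvgD; [exact: cvg_fst|exact: cvg_snd].
  by apply: compact_setX => //; exact: cbox_compact.
apply/seteqP; split => [y [x Kx /(rV_norm_leP _ r0) yx]|_ [[x v] [/= Kx vr] <-]].
  exists (x, y - x); rewrite /= ?(addrC x) ?subrK//; split => // j.
  by rewrite /= !(mxE const_mx_key); have := yx j; rewrite ler_norml.
exists x => //; rewrite addrAC subrr add0r; apply/rV_norm_leP => // j.
by have := vr j; rewrite !(mxE const_mx_key) ler_norml.
Qed.

Lemma open_thickening_open K r : open [set y | exists2 x, K x & `|y - x| < r].
Proof.
rewrite (_ : [set y | _] = \bigcup_(x in K) ball x r).
  apply: bigcup_open => x Kx; have [r0|r0] := ltP 0 r; first exact: ball_open.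
  rewrite (_ : ball x r = set0); first exact: open0.
  by apply/seteqP; split => // y []; rewrite ltNge r0.
apply/seteqP; split => y /= [x Kx h]; exists x => //; move: h;
  by rewrite mx_norm_ball /ball_/= distrC.
Qed.

Lemma partial_bounded D phi : test_function D phi ->
  exists C, forall x, `|phi x| <= C /\ `|partial i phi x| <= C.
Proof.
move=> [smooth cK _]; have [/= cphi /(_ i) [_ cpartial]] := smooth 1%N.
have bdd (f : 'rV[R]_n -> R) : continuous f ->
    exists C, forall x, closure [set x | phi x != 0] x -> `|f x| <= C.
  move=> cf; have : bounded_set (f @` closure [set x | phi x != 0]).
    apply: compact_bounded; apply: continuous_compact => //.
    exact: continuous_subspaceT.
  move=> [M [_ hM]]; exists (M + 1) => x Kx.
  have M1 : M < M + 1 by rewrite ltrDl.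
  by apply: (hM _ M1); exists x.
have [C1 h1] := bdd _ cphi; have [C2 h2] := bdd _ cpartial.
(* The entry 0 takes care of points outside the support, where [C1] and [C2] say nothing. *)
exists (Num.max 0 (Num.max C1 C2)) => x; rewrite !le_max.
have [Kx|Kx] := pselect (closure [set x | phi x != 0] x).
  by rewrite (h1 x Kx) (h2 x Kx) !orbT.
have -> : phi x = 0.
  by apply/eqP; apply: contrapT => /negP p; apply: Kx; exact: subset_closure.
have -> : partial i phi x = 0.
  by apply/eqP; apply: contrapT => /negP p; apply: Kx; exact: partial_support.
by rewrite normr0 lexx.
Qed.

(** Mean value theorem on the segment from x - h e to x. *)
Lemma difference_le D phi C (h : R) x : test_function D phi ->
  (forall x, `|partial i phi x| <= C) -> 0 < h ->
  `|(phi x - phi (x - h *: e)) / h| <= C.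
Proof.
move=> [smooth _ _] hC h0.
have [/= cphi /(_ i) [dphi _]] := smooth 1%N.
have dF (t : R) : is_derive t 1 (fun s => phi (x + s *: e)) (partial i phi (x + t *: e)).
  exact: is_derive_line1.
have h0' : - h <= 0 by rewrite oppr_le0 ltW.
have [|c _] := @MVT_segment R (fun s => phi (x + s *: e))
  (fun t => partial i phi (x + t *: e)) (- h) 0 h0'.
  by apply: continuous_subspaceT; exact: is_derive_continuous dF.
rewrite scale0r addr0 scaleNr sub0r opprK => ->.
by rewrite mulfK ?gt_eqF.
Qed.

Lemma cvg_difference D phi (u : R^nat) x : test_function D phi ->
  (forall m, 0 < u m) -> u m @[m --> \oo] --> (0 : R) ->
  (phi x - phi (x - u m *: e)) / u m @[m --> \oo] --> partial i phi x.
Proof.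
move=> [smooth _ _] u0 uc.
have [/= cphi /(_ i) [dphi _]] := smooth 1%N.
have cF : h^-1 *: (phi (h *: e + x) - phi x) @[h --> (0 : R)^'] --> partial i phi x.
  exact: (dphi x).
have cu : (- u m) @[m --> \oo] --> (0 : R) by rewrite -oppr0; exact: cvgN.
have un m : - u m != 0 by rewrite oppr_eq0 lt0r_neq0.
have := (cvgr_dnbhsP _ _ _).1 cF (fun m => - u m) (conj un cu).
apply: cvg_trans; apply: near_eq_cvg; apply: nearW => m /=.
by rewrite scaleNr (addrC _ x) invrN [_ *: _]mulNr -mulrN opprB mulrC.
Qed.

End support.

Lemma Rdominated_convergence d (T : measurableType d) (R : realType)
    (m : {measure set T -> \bar R}) (f_ : nat -> T -> R) (f g : T -> R) :
  (forall k, measurable_fun setT (f_ k)) -> measurable_fun setT f ->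
  {ae m, forall x, f_ k x @[k --> \oo] --> f x} ->
  m.-integrable setT (EFin \o g) ->
  {ae m, forall x, forall k, `|f_ k x| <= g x} ->
  \int[m]_x f_ k x @[k --> \oo] --> \int[m]_x f x.
Proof.
move=> mf_ mf fcvg intg fg.
have [||||| intf _ cvg] := @dominated_convergence _ _ _ m setT measurableT
  (fun k x => (f_ k x)%:E) (EFin \o f) (EFin \o g).
- by move=> k; exact/measurable_EFinP.
- exact/measurable_EFinP.
- apply: filterS fcvg => x fx _; apply: cvg_EFin; first exact: nearW.
  exact: fx.
- exact: intg.
- by apply: filterS fg => x fx k _; rewrite /= lee_fin.
apply: fine_cvg; rewrite fineK//.
exact: integrable_fin_num.
Qed.

(** * Bounded weak partial derivatives *)

Section weak_partial.
Context (R : realType) (n : nat).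
Implicit Types (x : 'rV[R]_n) (K D : set 'rV[R]_n) (u g phi : 'rV[R]_n -> R).
Local Notation mu := (lebesgue_rV R n).
Local Notation e i := (delta_mx 0 i : 'rV[R]_n).

(** One direction at a time, with [g] bounded at every point and not just almost everywhere. The
    class is stable under linear combinations and positive parts, hence under the projection. *)
Definition bounded_weak_partial D i u g : Prop :=
  [/\ measurable_fun setT u, locally_integrable_on D u, measurable_fun setT g,
      exists M, forall x, `|g x| <= M &
      forall phi, test_function D phi ->
        \int[mu]_(x in D) (u x * partial i phi x) =
        - \int[mu]_(x in D) (g x * phi x)].

Lemma Rintegral_patch D K (f psi : 'rV[R]_n -> R) : K `<=` D ->
  (forall x, psi x != 0 -> K x) ->
  \int[mu]_(x in D) (f x * psi x) = \int[mu]_x ((f \_ K) x * psi x).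
Proof.
move=> KD psiK; rewrite (@Rintegral_support _ _ K)//; last first.
  by move=> x; rewrite mulf_eq0 negb_or => /andP[_ /psiK].
rewrite Rintegral_mkcond; apply: eq_Rintegral => x _.
by rewrite !patchE; case: ifP => //; rewrite mul0r.
Qed.

Lemma neq0_support phi x : phi x != 0 -> closure [set x | phi x != 0] x.
Proof. by move=> px; exact: subset_closure. Qed.

Lemma integrable_patch K (f : 'rV[R]_n -> R) : measurable K ->
  mu.-integrable K (EFin \o f) -> mu.-integrable setT (EFin \o (f \_ K)).
Proof.
move=> mK intf; rewrite -restrict_EFin; apply/integrable_restrict => //=.
by rewrite setTI.
Qed.

Lemma bounded_integrable K (f : 'rV[R]_n -> R) M : compact K ->
  measurable_fun setT f -> (forall x, `|f x| <= M) -> mu.-integrable K (EFin \o f).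
Proof.
move=> cK mf fM; apply: (@measurable_bounded_integrable _ _ _ mu).
- exact: compact_measurable_rV.
- exact: compact_fin.
- exact: measurable_funS mf.
- exists M; split; first exact: num_real.
  by move=> y My t _; apply: le_trans (fM _) _; exact: ltW.
Qed.

Lemma measurable_partial D i phi : test_function D phi ->
  measurable_fun setT phi /\ measurable_fun setT (partial i phi).
Proof.
move=> [/(_ 1%N)/= [cphi /(_ i)[_ cp]] _ _].
by split; exact: continuous_measurable_rV.
Qed.

Lemma bounded_weak_partial_lin D i (c : R) u g v k :
  bounded_weak_partial D i u g -> bounded_weak_partial D i v k ->
  bounded_weak_partial D i (fun x => c * u x + v x) (fun x => c * g x + k x).
Proof.
move=> [mu_ lu mg [M gM] ug] [mv lv mk [N kN] vk]; split.
- by apply: measurable_funD => //; exact: measurable_funM.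
- move=> K cK KD.
  have i1 : mu.-integrable K (EFin \o (fun x => c * u x)).
    rewrite (_ : _ \o _ = (fun x => c%:E * (u x)%:E)%E)//.
    by apply: integrableZl; [exact: compact_measurable_rV|exact: lu].
  exact: (integrableD (compact_measurable_rV cK) i1 (lv K cK KD)).
- by apply: measurable_funD => //; exact: measurable_funM.
- exists (`|c| * M + N) => x; rewrite (le_trans (ler_normD _ _))// lerD//.
  by rewrite normrM ler_wpM2l.
- move=> phi tphi; have [_ cK KD] := tphi.
  set K := closure _ in cK KD.
  have [C hC] := partial_bounded i tphi.
  have [mphi mpphi] := measurable_partial i tphi.
  have mK := compact_measurable_rV cK.
  have red (f psi : 'rV[R]_n -> R) : (forall x, psi x != 0 -> K x) ->
      \int[mu]_(x in D) (f x * psi x) = \int[mu]_(x in K) (f x * psi x).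
    move=> psiK; apply: Rintegral_support => // x.
    by rewrite mulf_eq0 negb_or => /andP[_ /psiK].
  have lin (f h psi : 'rV[R]_n -> R) : mu.-integrable K (EFin \o f) ->
      mu.-integrable K (EFin \o h) -> measurable_fun setT psi ->
      (forall x, `|psi x| <= C) -> (forall x, psi x != 0 -> K x) ->
      \int[mu]_(x in D) ((c * f x + h x) * psi x) =
      c * \int[mu]_(x in D) (f x * psi x) + \int[mu]_(x in D) (h x * psi x).
    move=> intf inth mpsi psiC psiK; rewrite !red//.
    have mpsiK : measurable_fun K psi by exact: measurable_funS mpsi.
    have if_ := integrableM_bounded mK intf mpsiK (fun x _ => psiC x).
    have ih_ := integrableM_bounded mK inth mpsiK (fun x _ => psiC x).
    rewrite -RintegralZl// -RintegralD//.
      by apply: eq_Rintegral => x _; rewrite mulrDl mulrA.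
    rewrite (_ : _ \o _ = (fun x => c%:E * (f x * psi x)%:E)%E)//.
    exact: integrableZl.
  rewrite !lin//.
  + by rewrite ug// vk//; lra.
  + exact: (bounded_integrable cK mg gM).
  + exact: (bounded_integrable cK mk kN).
  + by move=> x; have [] := hC x.
  + exact: neq0_support.
  + exact: lu.
  + exact: lv.
  + by move=> x; have [] := hC x.
  + exact: partial_support.
Qed.

End weak_partial.

(** * Passage to the limit in the regularised positive part *)

Section positive_part.
Context (R : realType) (n : nat) (i : 'I_n).
Implicit Types (x : 'rV[R]_n) (K D : set 'rV[R]_n) (u g phi : 'rV[R]_n -> R).
Local Notation mu := (lebesgue_rV R n).
Local Notation e := (delta_mx 0 i : 'rV[R]_n).

Lemma norm_line (t : R) : `|t *: e| <= `|t|.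
Proof.
apply/rV_norm_leP => // j; rewrite !mxE eqxx/= normrM.
by case: (j == i); rewrite ?normr1 ?mulr1// normr0 mulr0.
Qed.

Lemma pospart_le (s : R) : `|pospart s| <= `|s|.
Proof. by rewrite pospartE; case: ifP => //; rewrite normr0. Qed.

Lemma huber_le (eps s : R) : 0 < eps -> `|huber eps s| <= `|s|.
Proof.
by move=> e0; have := huber_lipschitz 0 s e0; rewrite huber0// !subr0.
Qed.

(* The Huber parameter tends to zero more slowly than the step of the
   difference quotient, so that the quadratic error of [huber_quadratic]
   vanishes in the limit. *)
Let step (r : R) (m : nat) : R := r * harmonic m * harmonic m.

Let step_gt0 r m : 0 < r -> 0 < step r m.
Proof. by move=> r0; rewrite /step !mulr_gt0// invr_gt0. Qed.

Let harmonic_gt0 m : 0 < harmonic m :> R.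
Proof. by rewrite invr_gt0. Qed.

Let step_cvg r : step r m @[m --> \oo] --> (0 : R).
Proof.
rewrite /step -(mulr0 (r * 0)); apply: cvgM; last exact: cvg_harmonic.
by apply: cvgM; [exact: cvg_cst|exact: cvg_harmonic].
Qed.

Section limits.
Context (K O : set 'rV[R]_n) (u g phi : 'rV[R]_n -> R) (r M C : R).
Hypotheses (r0 : 0 < r) (cK : compact K) (KO : K `<=` O).
Hypotheses (intu : mu.-integrable setT (EFin \o u)).
Hypotheses (intg : mu.-integrable setT (EFin \o g)) (gM : forall x, `|g x| <= M).
Hypotheses (uE : forall m, {ae mu, forall x, O x ->
  u (x + step r m *: e) - u x = average i g (step r m) x}).
Hypotheses (tphi : test_function K phi).
Hypotheses (phiC : forall x, `|phi x| <= C /\ `|partial i phi x| <= C).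

Let mu_ : measurable_fun setT u.
Proof. by apply/measurable_EFinP; exact: measurable_int intu. Qed.

Let mg : measurable_fun setT g.
Proof. by apply/measurable_EFinP; exact: measurable_int intg. Qed.

Let H m x := huber (harmonic m) (u x).

Let mH m : measurable_fun setT (H m).
Proof. exact: measurableT_comp (measurable_huber _) mu_. Qed.

Let mphi : measurable_fun setT phi.
Proof. by have [] := measurable_partial i tphi. Qed.

Let intH m : mu.-integrable setT (EFin \o H m).
Proof.
apply: (le_integrable measurableT _ _ intu); first exact/measurable_EFinP.
by move=> x _; rewrite /= lee_fin; exact: huber_le.
Qed.

Let quotient_cvg1 :
  \int[mu]_x (H m x * ((phi x - phi (x - step r m *: e)) / step r m)) @[m --> \oo]
    --> \int[mu]_x (pospart (u x) * partial i phi x).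
Proof.
apply: (@Rdominated_convergence _ _ _ mu _ _ (fun x => `|u x| * C)).
- move=> m; apply: measurable_funM => //; apply: measurable_funM => //.
  apply: measurable_funB => //.
  exact: (measurable_comp_shift (- (step r m *: e)) mphi).
- apply: measurable_funM; first exact: measurableT_comp (@measurable_pospart R) mu_.
  by have [] := measurable_partial i tphi.
- apply: aeW => x; apply: cvgM; first exact: cvg_huber.
  exact: (cvg_difference tphi (fun m => step_gt0 m r0) (@step_cvg r)).
- apply: (integrableM_bounded measurableT (integrable_norm intu) (C := `|C|)) => //.
- apply: aeW => x m; rewrite normrM ler_pM//; first exact: huber_le.
  apply: (difference_le _ tphi); last exact: step_gt0.
  by move=> y; have [] := phiC y.
Qed.

Let average_le m x : `|average i g (step r m) x| <= M * step r m.
Proof.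
have [] // := @bounded_itv_integral R (fun t => g (x + t *: e)) (step r m) M.
- exact/ltW/step_gt0.
- exact: (measurableT_comp mg (measurable_line i x)).
Qed.

(** With step h and Huber parameter eps, the quotient is [dhuber] times the mean of [g] up to an
    error of at most M^2 h / (2 eps), which tends to 0. It is dominated by M on [K] because [huber]
    is 1-Lipschitz. The steps form a sequence, so one null set serves for all of them. *)
Let quotient_cvg2 :
  \int[mu]_x (phi x * ((H m (x + step r m *: e) - H m x) / step r m)) @[m --> \oo]
    --> \int[mu]_x (phi x * (if 0 < u x then g x else 0)).
Proof.
have M0 : 0 <= M := le_trans (normr_ge0 _) (gM 0).
have phiK x : phi x != 0 -> K x.
  by move=> /neq0_support; have [_ _] := tphi; apply.
apply: (@Rdominated_convergence _ _ _ mu _ _ (fun x => C * M * \1_K x)).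
- move=> m; apply: measurable_funM => //; apply: measurable_funM => //.
  by apply: measurable_funB => //; exact: (measurable_comp_shift (step r m *: e) (mH m)).
- apply: measurable_funM => //.
  apply: measurable_fun_ifT => //.
  exact: measurable_fun_ltr.
- have := average_cvg i intg gM (fun m => step_gt0 m r0) (@step_cvg r).
  apply: filterS2 (ae_foralln uE) => x ux gx.
  (* The difference identity is known on [O] only; where it may fail, the factor [phi x] is zero. *)
  have [px|/phiK/KO Ox] := eqVneq (phi x) 0.
    rewrite px mul0r; under eq_fun do rewrite mul0r; exact: cvg_cst.
  apply: cvgM; first exact: cvg_cst.
  pose rest m := (H m (x + step r m *: e) - H m x) / step r m -
    dhuber (harmonic m) (u x) * (average i g (step r m) x / step r m).
  have c2 : rest m @[m --> \oo] --> (0 : R).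
    have cM (c : R) : c * harmonic m @[m --> \oo] --> (0 : R).
      by rewrite -(mulr0 c); apply: cvgM; [exact: cvg_cst|exact: cvg_harmonic].
    apply: (@squeeze_cvgr _ _ _ _ (fun m => - (M ^+ 2 * r) * harmonic m)
      (fun m => M ^+ 2 * r * harmonic m)); [|exact: cM|exact: cM].
    apply: nearW => m; rewrite mulNr -ler_norml.
    have h0 := step_gt0 m r0; have e0 := harmonic_gt0 m.
    have := huber_quadratic (u x) (u (x + step r m *: e)) e0.
    rewrite (ux m Ox) => hq.
    have -> : rest m = (H m (x + step r m *: e) - H m x -
        dhuber (harmonic m) (u x) * average i g (step r m) x) / step r m.
      by rewrite /rest; field; rewrite lt0r_neq0.
    rewrite normrM normfV (gtr0_norm h0) ler_pdivrMr//; apply: le_trans hq _.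
    rewrite ler_pdivrMr ?mulr_gt0// -real_normK ?num_real//.
    have : `|average i g (step r m) x| ^+ 2 <= (M * step r m) ^+ 2.
      by rewrite ler_sqr ?nnegrE ?(mulr_ge0 M0 (ltW h0)) ?average_le.
    move=> /le_trans; apply; rewrite exprMn /step.
    have P : 0 <= M ^+ 2 * r ^+ 2 * (harmonic m ^+ 4).
      by rewrite !mulr_ge0 ?sqr_ge0 ?exprn_ge0// ltW.
    by move: P; set k := harmonic m; lra.
  have c3 : rest m + dhuber (harmonic m) (u x) * (average i g (step r m) x / step r m)
      @[m --> \oo] --> 0 + (if 0 < u x then 1 else 0) * g x.
    by apply: cvgD => //; apply: cvgM => //; exact: cvg_dhuber.
  move: c3; rewrite add0r.
  rewrite (_ : (if 0 < u x then 1 else 0) * g x = if 0 < u x then g x else 0); last first.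
    by case: ifP; rewrite ?mul1r ?mul0r.
  apply: cvg_trans; apply: near_eq_cvg; apply: nearW => m /=.
  by rewrite /rest subrK.
- rewrite (_ : (fun x => _) = (cst (C * M)) \_ K); last first.
    by apply/funext => x; rewrite patchE indicE; case: ifP; rewrite ?mulr1 ?mulr0.
  apply: integrable_patch; first exact: compact_measurable_rV.
  exact: (bounded_integrable (M := `|C * M|) cK).
- apply: filterS (ae_foralln uE) => x ux m.
  have [px|/phiK Kx] := eqVneq (phi x) 0.
    rewrite px mul0r normr0 mulr_ge0 ?indicE// mulr_ge0//.
    by rewrite (le_trans (normr_ge0 (phi x)))//; have [] := phiC x.
  rewrite indicE mem_set// mulr1 normrM ler_pM//; first by have [] := phiC x.
  rewrite normrM normfV (gtr0_norm (step_gt0 m r0)) ler_pdivrMr ?step_gt0//.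
  apply: le_trans (huber_lipschitz _ _ (harmonic_gt0 m)) _.
  rewrite (ux m (KO Kx)).
  exact: average_le.
Qed.

(** Translation invariance gives summation by parts: the backward quotient of [phi] against [H m] is
    minus the forward quotient of [H m] against [phi]. Both sides converge, and limits are
    unique. *)
Lemma limit_identity : \int[mu]_x (pospart (u x) * partial i phi x) =
  - \int[mu]_x ((if 0 < u x then g x else 0) * phi x).
Proof.
have -> : \int[mu]_x ((if 0 < u x then g x else 0) * phi x) =
    \int[mu]_x (phi x * (if 0 < u x then g x else 0)).
  by apply: eq_Rintegral => x _; rewrite mulrC.
apply: (cvg_unique _ quotient_cvg1); first exact: Rhausdorff.
rewrite [X in X @ _](_ : _ = (fun m => - \int[mu]_x (phi x *
    ((H m (x + step r m *: e) - H m x) / step r m)))); last first.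
  apply/funext => m; have h0 := step_gt0 m r0.
  have phiC1 x : `|phi x| <= C by have [] := phiC x.
  have i1 := integrableM_bounded measurableT (intH m) mphi (fun x _ => phiC1 x).
  have i2 := integrableM_bounded measurableT (integrable_shift (step r m *: e) (intH m))
    mphi (fun x _ => phiC1 x).
  have mphis := measurable_comp_shift (- (step r m *: e)) mphi.
  have i3 := integrableM_bounded measurableT (intH m) mphis
    (fun x _ => phiC1 (x - step r m *: e)).
  have E : \int[mu]_x (H m x * phi (x - step r m *: e)) =
           \int[mu]_x (H m (x + step r m *: e) * phi x).
    rewrite -(Rintegral_shift (step r m *: e)).
      by apply: eq_Rintegral => x _; rewrite addrK.
    by apply: measurable_funM.
  have -> : \int[mu]_x (H m x * ((phi x - phi (x - step r m *: e)) / step r m)) =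
      (\int[mu]_x (H m x * phi x) - \int[mu]_x (H m x * phi (x - step r m *: e))) / step r m.
    rewrite -RintegralB// -RintegralZr//.
      by apply: eq_Rintegral => x _; ring.
    exact: (integrableB measurableT i1 i3).
  have -> : \int[mu]_x (phi x * ((H m (x + step r m *: e) - H m x) / step r m)) =
      (\int[mu]_x (H m (x + step r m *: e) * phi x) - \int[mu]_x (H m x * phi x)) / step r m.
    rewrite -RintegralB// -RintegralZr//.
      by apply: eq_Rintegral => x _; ring.
    exact: (integrableB measurableT i2 i1).
  by rewrite E -mulNr opprB.
exact: cvgN quotient_cvg2.
Qed.

End limits.

End positive_part.

(** * Calculus of weak gradients *)

Section weak_calculus.
Context (R : realType) (n : nat).
Implicit Types (x : 'rV[R]_n) (K D : set 'rV[R]_n) (u v g phi : 'rV[R]_n -> R).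
Local Notation mu := (lebesgue_rV R n).
Local Notation e i := (delta_mx 0 i : 'rV[R]_n).

(** All is localised near the support [K] of the test function. On the closed r-thickening [L] of
    [K], still inside [D], both functions are cut off by zero; the difference identity then holds on
    the open r/2-neighbourhood of [K] for steps of at most r/2. *)
Lemma bounded_weak_partial_pospart D i u g : open D ->
  bounded_weak_partial D i u g ->
  bounded_weak_partial D i (fun x => pospart (u x)) (fun x => if 0 < u x then g x else 0).
Proof.
move=> oD [mu_ lu mg [M gM] ug].
have M0 : 0 <= M := le_trans (normr_ge0 _) (gM 0).
have mv : measurable_fun setT (fun x => if 0 < u x then g x else 0).
  by apply: measurable_fun_ifT => //; exact: measurable_fun_ltr.
have mpu : measurable_fun setT (fun x => pospart (u x)).
  exact: (measurableT_comp (@measurable_pospart R) mu_).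
split => //.
- move=> K cK KD; apply: (le_integrable (compact_measurable_rV cK) _ _ (lu K cK KD)).
    by apply/measurable_EFinP; exact: measurable_funS mpu.
  by move=> x _; rewrite /= lee_fin; exact: pospart_le.
- by exists M => x; case: ifP => // _; rewrite normr0.
move=> phi tphi; have [smooth cK KD] := tphi.
set K := closure _ in cK KD.
have [r r0 rD] := compact_thickening cK oD KD.
pose L := thickening K r.
have cL : compact L by apply: thickening_compact => //; exact: ltW.
have LD : L `<=` D by move=> y [x Kx yx]; exact: rD yx.
have KL : K `<=` L.
  by move=> x Kx; exists x => //; rewrite subrr normr0 ltW.
have mL := compact_measurable_rV cL.
pose O := [set y : 'rV[R]_n | exists2 x, K x & `|y - x| < r / 2].
have r2 : 0 < r / 2 by rewrite divr_gt0.
pose u' := u \_ L; pose g' := g \_ L.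
have intu : mu.-integrable setT (EFin \o u') by apply: integrable_patch => //; exact: lu.
have intg : mu.-integrable setT (EFin \o g').
  by apply: integrable_patch => //; exact: (bounded_integrable cL mg gM).
have gM' x : `|g' x| <= M by rewrite /g' patchE; case: ifP => //; rewrite normr0.
have KO : K `<=` O.
  by move=> x Kx; exists x => //; rewrite subrr normr0.
have ug' psi : test_function L psi ->
    \int[mu]_x (u' x * partial i psi x) = - \int[mu]_x (g' x * psi x).
  move=> [spsi cpsi psiL].
  rewrite -(Rintegral_patch _ LD); last by move=> x /partial_support; exact: psiL.
  rewrite -(Rintegral_patch _ LD); last by move=> x /neq0_support; exact: psiL.
  by apply: ug; split => //; exact: subset_trans LD.
have uE m : {ae mu, forall x, O x ->
    u' (x + (r / 2 * harmonic m * harmonic m) *: e i) - u' x =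
    average i g' (r / 2 * harmonic m * harmonic m) x}.
  have h0 : 0 < harmonic m :> R by rewrite invr_gt0.
  have h1 : harmonic m <= 1 :> R by rewrite invf_le1// ler1n.
  apply: (difference_average (D := L) _ _ _ intu intg gM' ug').
  - by rewrite !mulr_gt0.
  - exact: open_thickening_open.
  - move=> x t [y Ky xy] /andP[t0 th]; exists y => //.
    rewrite addrAC (le_trans (ler_normD _ _))// (splitr r) lerD ?(ltW xy)//.
    rewrite (le_trans (norm_line _ _))// ger0_norm// (le_trans th)//.
    by rewrite -mulrA ger_pMr// mulr_ile1// ltW.
have [C phiC] := partial_bounded i tphi.
have tphiK : test_function K phi by split.
have E := limit_identity r2 cK KO intu intg gM' uE tphiK phiC.
(* Cutting off commutes with the positive part, and likewise with its derivative, because both give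
   0 where the cut-off function is 0. *)
have posE x : pospart (u' x) = ((fun x => pospart (u x)) \_ L) x.
  by rewrite /u' !patchE; case: ifP => // _; rewrite /pospart maxxx.
have gE x : (if 0 < u' x then g' x else 0) =
    ((fun x => if 0 < u x then g x else 0) \_ L) x.
  by rewrite /u' /g' !patchE; case: (x \in L) => //; rewrite ltxx.
rewrite (Rintegral_patch _ LD); last by move=> x /partial_support/KL.
rewrite [in RHS](Rintegral_patch _ LD); last by move=> x /neq0_support/KL.
transitivity (\int[mu]_x (pospart (u' x) * partial i phi x)).
  by apply: eq_Rintegral => x _; rewrite posE.
by rewrite E; congr (- _); apply: eq_Rintegral => x _; rewrite gE.
Qed.

(** Transfers what is known of an explicitly computed gradient to the one selected by
    [weak_gradient]. *)
Lemma weak_partial_unique D u (g g' : 'rV[R]_n -> 'rV[R]_n) i : open D ->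
  is_weak_gradient D u g -> is_weak_gradient D u g' ->
  {ae mu, forall x, D x -> g x 0 i = g' x 0 i}.
Proof.
move=> oD [lu mg lg ug] [_ mg' lg' ug'].
suff : {ae mu, forall x, D x -> g x 0 i - g' x 0 i = 0}.
  by apply: filterS => x + Dx => /(_ Dx)/eqP; rewrite subr_eq0 => /eqP.
apply: fundamental_lemma => //.
  move=> K cK KD; have mK := compact_measurable_rV cK.
  exact: (integrableB mK (lg i K cK KD) (lg' i K cK KD)).
move=> s a b s0 abD; have tb := test_box_bump s0 abD.
have mC : measurable (cbox a b) by exact: measurable_cbox.
have := ug _ i tb; rewrite ug' // => /oppr_inj.
have bC x : box_bump s a b x != 0 -> cbox a b x by exact: box_bump_neq0.
have red f : \int[mu]_(x in D) (f x * box_bump s a b x) =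
    \int[mu]_(x in cbox a b) (f x * box_bump s a b x).
  apply: Rintegral_support => // x.
  by rewrite mulf_eq0 negb_or => /andP[_ /bC].
rewrite (red (fun x => g x 0 i)) (red (fun x => g' x 0 i)) => E.
have mb : measurable_fun (cbox a b) (box_bump s a b).
  apply: (measurable_funS measurableT) => //.
  by apply: continuous_measurable_rV; exact: continuous_box_bump.
have b1 x : cbox a b x -> `|box_bump s a b x| <= 1.
  by rewrite ger0_norm ?box_bump_ge0// box_bump_le1.
have cC := @cbox_compact R n a b.
have i1 := integrableM_bounded mC (lg i _ cC abD) mb b1.
have i2 := integrableM_bounded mC (lg' i _ cC abD) mb b1.
under eq_Rintegral do rewrite mulrBl.
by rewrite RintegralB// -E subrr.
Qed.

(** Inside [D], values exceeding M occur on a null set only; resetting them to 0 makes the bound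
    hold everywhere without changing any integral over [D]. *)
Lemma weak_gradient_bounded_partial D u (g : 'rV[R]_n -> 'rV[R]_n) (M : R) i :
  measurable D -> measurable_fun setT u -> is_weak_gradient D u g -> 0 <= M ->
  {ae mu, forall x, D x -> `|g x 0 i| <= M} ->
  bounded_weak_partial D i u (fun x => if `|g x 0 i| <= M then g x 0 i else 0).
Proof.
move=> mD mu_ [lu mg lg ug] M0 gM.
have mtrunc : measurable_fun setT (fun x => if `|g x 0 i| <= M then g x 0 i else 0).
  apply: measurable_fun_ifT => //; apply: measurable_fun_ler => //.
  exact: measurableT_comp.
split => //.
- by exists M => x; case: ifP => //; rewrite normr0.
move=> phi tphi; rewrite ug//; congr (- _); rewrite /Rintegral; congr fine.
have [mphi _] := measurable_partial i tphi.
apply: ae_eq_integral => //.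
- apply/measurable_EFinP; apply: (measurable_funS measurableT) => //.
  exact: measurable_funM.
- apply/measurable_EFinP; apply: (measurable_funS measurableT) => //.
  exact: measurable_funM.
by apply: filterS gM => x + Dx => /(_ Dx) /= ->.
Qed.

Lemma is_weak_gradient_partials D u (g : 'I_n -> 'rV[R]_n -> R) :
  (0 < n)%N -> (forall i, bounded_weak_partial D i u (g i)) ->
  is_weak_gradient D u (fun x => \row_i g i x).
Proof.
move=> n0 H; have [_ lu _ _ _] := H (Ordinal n0); split => //.
- move=> i; under eq_fun do rewrite mxE.
  by have [] := H i.
- move=> i K cK KD.
  have [_ _ mg [M gM] _] := H i.
  under eq_fun do rewrite /= mxE.
  exact: (bounded_integrable cK mg gM).
- move=> phi i tphi; have [_ _ _ _ ->//] := H i.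
  by congr (- _); apply: eq_Rintegral => x _; rewrite mxE.
Qed.

End weak_calculus.

(** * The projection formula *)

Definition clamp (R : realType) (a b v : R) : R := Num.max a (Num.min b v).

(** With v = - c q, first min(b, v) = b - (b - v)^+, then max(a, w) = a + (w - a)^+. The non-strict
    test against [a] reflects the value 0 of the derivative of a positive part on its zero set. *)
Lemma bounded_weak_partial_clamp (R : realType) (n : nat) (D : set 'rV[R]_n) (i : 'I_n)
    (a ga b gb q gq : 'rV[R]_n -> R) (c : R) : open D ->
  bounded_weak_partial D i a ga -> bounded_weak_partial D i b gb ->
  bounded_weak_partial D i q gq ->
  bounded_weak_partial D i (fun x => clamp (a x) (b x) (- (c * q x)))
    (fun x => if Num.min (b x) (- (c * q x)) <= a x then ga x else
              if - (c * q x) < b x then - (c * gq x) else gb x).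
Proof.
move=> oD Ha Hb Hq.
have H1 := bounded_weak_partial_lin c Hq Hb.
have H2 := bounded_weak_partial_pospart oD H1.
have H3 := bounded_weak_partial_lin (-1) H2 Hb.
have H4 := bounded_weak_partial_lin (-1) Ha H3.
have H5 := bounded_weak_partial_pospart oD H4.
have H6 := bounded_weak_partial_lin 1 H5 Ha.
set w := (X in bounded_weak_partial _ _ X _) in H6.
set g := (X in bounded_weak_partial _ _ _ X) in H6.
have mE x : -1 * pospart (c * q x + b x) + b x = Num.min (b x) (- (c * q x)).
  rewrite pospartE mulN1r; set y := c * q x.
  by case: (leP 0 (y + b x)) => h1; case: (leP (b x) (- y)) => h2; lra.
have wE : (fun x => clamp (a x) (b x) (- (c * q x))) = w.
  apply/funext => x; rewrite /w mE /clamp pospartE mulN1r mul1r.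
  set m := Num.min _ _.
  by case: (leP 0 (- a x + m)) => h1; case: (leP (a x) m) => h2; lra.
have gE : (fun x => if Num.min (b x) (- (c * q x)) <= a x then ga x else
    if - (c * q x) < b x then - (c * gq x) else gb x) = g.
  apply/funext => x; rewrite /g mE; set m := Num.min _ _.
  rewrite (_ : (0 < -1 * a x + m) = (a x < m)); last first.
    by rewrite mulN1r addrC subr_gt0.
  rewrite (_ : (0 < c * q x + b x) = (- (c * q x) < b x)); last first.
    by rewrite addrC -{1}(opprK (c * q x)) subr_gt0.
  by case: (leP m (a x)) => h1; case: (ltP (- (c * q x)) (b x)) => h2; lra.
by rewrite wE gE.
Qed.

Section projection.
Context (R : realType) (n : nat) (D : set 'rV[R]_n) (mD : measurable D).
Local Notation m := (lebesgue_on mD).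
Local Notation L2 := (L2 mD).

Lemma ae_lebesgue_on (P : set 'rV[R]_n) :
  {ae m, forall x, P x} <-> {ae lebesgue_rV R n, forall x, D x -> P x}.
Proof.
split=> -[N [mN N0 PN]].
  exists (N `&` D); split => //; first exact: measurableI.
  by move=> x /not_implyP[Dx Px]; split => //; exact: PN.
exists (N `|` ~` D); split.
- by apply: measurableU => //; exact: measurableC.
- change (lebesgue_rV R n ((N `|` ~` D) `&` D) = 0%E).
  rewrite setIUl setICl setU0; apply: (subset_measure0 _ mN _ N0) => //.
  exact: measurableI.
move=> x /= Px; have [Dx|] := pselect (D x); last by right.
by left; apply: PN => /(_ Dx).
Qed.

Lemma L2_addE (u v : L2) (t : R) x : (u + t *: v) x = u x + t * v x.
Proof. by []. Qed.

Lemma L2_subE (u v : L2) x : (u - v) x = u x - v x.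
Proof. by []. Qed.

Lemma L2_mulP (u v : L2) : m.-integrable setT (EFin \o (fun x => u x * v x)).
Proof.
apply/Lfun1_integrable.
have := @Lfun2_mul_Lfun1 _ _ _ m u v.
by apply; exact: LfunP.
Qed.

Lemma L2_norm_sqr (u : L2) : L2_norm u ^+ 2 = L2_dot u u.
Proof.
have N0 := Lnorm_ge0 m 2%:E (EFin \o u).
have E : ('N[m]_2[EFin \o u] `^ 2 = \int[m]_x (u x * u x)%:E)%E.
  rewrite poweR_Lnorm//; apply: eq_integral => x _ /=.
  by rewrite powR_mulrn// real_normK// num_real.
rewrite /L2_norm /L2_dot /Rintegral -E.
have : ('N[m]_2[EFin \o u] < +oo)%E by exact: Lfunction_finite.
case: ('N[m]_2[EFin \o u])%E N0 => // r r0 _.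
by rewrite /= powR_mulrn.
Qed.

Lemma L2_dotDl (u v w : L2) (t : R) :
  L2_dot (u + t *: v) w = L2_dot u w + t * L2_dot v w.
Proof.
rewrite /L2_dot -RintegralZl//; last exact: L2_mulP.
rewrite -RintegralD//.
- by apply: eq_Rintegral => x _; rewrite L2_addE mulrDl mulrA.
- exact: L2_mulP.
- rewrite (_ : _ \o _ = (fun x => t%:E * (v x * w x)%:E)%E)//.
  by apply: integrableZl => //; exact: L2_mulP.
Qed.

Lemma L2_dotC (u v : L2) : L2_dot u v = L2_dot v u.
Proof. by apply: eq_Rintegral => x _; rewrite mulrC. Qed.

End projection.

(** First-order optimality at the end of a segment. If A < 0, the explicit t = - A / (- A + |B|)
    satisfies t |B| < - A, which makes the expression negative. *)
Lemma quadratic_ge0 (R : realFieldType) (A B : R) :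
  (forall t, 0 < t -> t <= 1 -> 0 <= t * A + t ^+ 2 * B) -> 0 <= A.
Proof.
move=> H; rewrite leNgt; apply/negP => A0.
pose t := - A / (- A + `|B|).
have d0 : 0 < - A + `|B| by rewrite ltr_wpDr// oppr_gt0.
have t0 : 0 < t by rewrite divr_gt0// oppr_gt0.
have t1 : t <= 1 by rewrite ler_pdivrMr// mul1r lerDl.
have := H _ t0 t1; rewrite expr2 -mulrA -mulrDr pmulr_rge0// leNgt => /negP; apply.
have tB : t * B <= t * `|B| by rewrite ler_wpM2l ?ler_norm// ltW.
apply: le_lt_trans (lerD (lexx A) tB) _.
rewrite /t mulrAC -ltrBrDl sub0r ltr_pdivrMr// ltr_pM2l ?oppr_gt0//.
by rewrite ltrDr oppr_gt0.
Qed.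

Lemma clamp_bounds (R : realType) (a b v : R) : a <= b -> a <= clamp a b v <= b.
Proof.
by move=> ab; rewrite /clamp le_max lexx/= ge_max ab ge_min lexx.
Qed.

(** * Variational inequality and pointwise projection *)

Section projection_formula.
Context (R : realType) (n : nat) (D : set 'rV[R]_n) (mD : measurable D).
Context (finD : (lebesgue_rV R n D < +oo)%E).
Context (H : completeNormedModType R) (dot : {dot H for idfun})
  (dotH : induces_norm dot) (z : H) (Y : normedModType R)
  (T : {linear L2 mD -> H}) (B : {linear L2 mD -> Y}) (S : {linear Y -> H})
  (cS : continuous S) (TE : forall u, T u = S (B u))
  (Bstar : (Y -> R) -> L2 mD) (BstarE : is_L2_adjoint B Bstar)
  (a b : 'rV[R]_n -> R).
Context (La : a \in Lfun (lebesgue_on mD) +oo%E) (Lb : b \in Lfun (lebesgue_on mD) +oo%E).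
Context (alpha : R) (alpha0 : 0 < alpha) (u : L2 mD) (sol : solves_P T z a b alpha u).
Local Notation m := (lebesgue_on mD).
Let q := Bstar (adjoint dot S (T u - z)).

Lemma dotC (h k : H) : dot h k = dot k h.
Proof. by rewrite hermC expr0 mul1r. Qed.

Lemma dotDZl (t : R) (h h' k : H) : dot (h + t *: h') k = dot h k + t * dot h' k.
Proof. by rewrite (linearDl dot k h (t *: h')) (linearZl_LR dot k t h'). Qed.

Lemma dotDZ (t : R) (h k : H) :
  dot (h + t *: k) (h + t *: k) = dot h h + 2 * t * dot h k + t ^+ 2 * dot k k.
Proof.
by rewrite dotDZl (dotC h) (dotC k (h + _)) !dotDZl (dotC k h); ring.
Qed.

Lemma dotE (h k : H) : dot h k = 4^-1 * (`|h + k| ^+ 2 - `|h - k| ^+ 2).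
Proof.
have E1 : h + k = h + 1 *: k by rewrite scale1r.
have E2 : h - k = h + -1 *: k by rewrite scaleN1r.
by rewrite -!dotH E1 E2 !dotDZ; field.
Qed.

Lemma scalar_adjoint h : scalar (adjoint dot S h).
Proof. by move=> c y y'; rewrite /adjoint linearP linearPr. Qed.

(** By polarization the functional is a combination of squared norms of h + S y and h - S y, so
    continuity of [S] suffices. *)
Lemma continuous_adjoint h : continuous (adjoint dot S h).
Proof.
have -> : adjoint dot S h =
    (fun y => 4^-1 * (`|h + S y| ^+ 2 - `|h - S y| ^+ 2)).
  by apply/funext => y; exact: dotE.
move=> y.
apply: cvgM; first exact: cvg_cst.
have c1 : `|h + S y0| @[y0 --> y] --> `|h + S y|.
  by apply: cvg_norm; apply: cvgD; [exact: cvg_cst|exact: cS].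
have c2 : `|h - S y0| @[y0 --> y] --> `|h - S y|.
  by apply: cvg_norm; apply: cvgB; [exact: cvg_cst|exact: cS].
by apply: cvgB; apply: cvgM.
Qed.

(** Thus [q] represents the derivative of the data term at [u]. *)
Lemma L2_dot_adjoint v : L2_dot q v = dot (T u - z) (T v).
Proof.
by rewrite /q (BstarE (@scalar_adjoint _) (@continuous_adjoint _)) /adjoint !TE.
Qed.

Lemma variational_inequality (v : L2 mD) : admissible a b v ->
  0 <= \int[m]_x ((q x + alpha * u x) * (v x - u x)).
Proof.
move=> adv; have [adu opt] := sol.
have -> : \int[m]_x ((q x + alpha * u x) * (v x - u x)) = L2_dot (q + alpha *: u) (v - u).
  by [].
pose d := v - u.
rewrite L2_dotDl L2_dot_adjoint -/d.
(* Along the segment from [u] to [v] the objective is exactly quadratic in t; this is its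
   coefficient of t^2. *)
apply: (@quadratic_ge0 _ _ (2^-1 * `|T d| ^+ 2 + alpha / 2 * L2_dot d d)) => t t0 t1.
have adt : @admissible R n D mD a b (u + t *: d).
  apply: filterS2 adu adv => x /andP[au ub] /andP[av vb].
  rewrite L2_addE /d L2_subE; apply/andP; split; nra.
have := opt _ adt; rewrite /objective !L2_norm_sqr.
have -> : T (u + t *: d) - z = (T u - z) + t *: T d.
  by rewrite linearD linearZ addrAC.
rewrite -!dotH.
set k := T u - z; set l := T d.
rewrite dotDZ.
have -> : L2_dot (u + t *: d) (u + t *: d) = L2_dot u u + 2 * t * L2_dot u d + t ^+ 2 * L2_dot d d.
  rewrite L2_dotDl (L2_dotC u) (L2_dotC d (u + _)) !L2_dotDl (L2_dotC d u); ring.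
rewrite dotH -subr_ge0 => h; apply: le_trans h _.
rewrite le_eqVlt; apply/orP; left; apply/eqP; by field.
Qed.

Lemma projection_formula :
  {ae m, forall x, u x = clamp (a x) (b x) (- (alpha^-1 * q x))}.
Proof.
have mfin : m setT \is a fin_num.
  rewrite ge0_fin_numE//; change (lebesgue_rV R n (setT `&` D) < +oo)%E.
  by rewrite setTI.
have La2 := Lfun_subset (lee1n 2) (leey _) mfin (leey _) La.
have Lb2 := Lfun_subset (lee1n 2) (leey _) mfin (leey _) Lb.
have ma : measurable_fun setT a := set_mem (sub_Lfun_mfun La).
have mb : measurable_fun setT b := set_mem (sub_Lfun_mfun Lb).
pose w x := clamp (a x) (b x) (- (alpha^-1 * q x)).
have mw : measurable_fun setT w.
  apply: measurable_maxr => //; apply: measurable_minr => //.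
  by apply: measurable_funN; apply: measurable_funM.
have wab x : `|w x| <= `|a x| + `|b x|.
  rewrite /w /clamp; set v := - _.
  have := normr_ge0 (a x); have := normr_ge0 (b x).
  case: (leP (b x) v) => h1; case: (leP (a x) _) => h2 ? ?; rewrite ?lerDl ?lerDr//.
  rewrite ler_norml; have := ler_norm (b x); have := ler_norm (- a x).
  by rewrite normrN => ? ?; apply/andP; split; lra.
have w2 : w \in Lfun m 2%:E.
  have intw : m.-integrable setT (EFin \o (fun x => w x ^+ 2)).
    have i1 := Lfun2_integrable_sqr La2; have i2 := Lfun2_integrable_sqr Lb2.
    apply: (le_integrable measurableT _ _
      (integrableZl measurableT 2 (integrableD measurableT i1 i2))).
      by apply/measurable_EFinP; exact: measurable_funX.
    move=> x _; rewrite /= lee_fin !ger0_norm ?sqr_ge0//; last first.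
      by rewrite mulr_ge0// addr_ge0// sqr_ge0.
    rewrite -(real_normK (num_real (w x))) -(real_normK (num_real (a x))).
    rewrite -(real_normK (num_real (b x))).
    have : `|w x| ^+ 2 <= (`|a x| + `|b x|) ^+ 2.
      by rewrite ler_sqr ?nnegrE ?addr_ge0.
    by have := sqr_ge0 (`|a x| - `|b x|); lra.
  rewrite inE; apply/andP; split; rewrite inE//=.
  rewrite /finite_norm unlock /Lnorm poweR_lty//.
  have /integrableP[_] := intw; apply: le_lt_trans.
  apply: ge0_le_integral => //=.
  - under eq_fun do rewrite powR_mulrn//.
    apply/measurable_EFinP; apply: measurable_funX.
    exact: (measurableT_comp (@normr_measurable _ _) mw).
  - apply/measurable_EFinP; have mw2 : measurable_fun setT (fun x => w x ^+ 2).
      exact: measurable_funX.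
    exact: (measurableT_comp (@normr_measurable _ _) mw2).
  - by move=> x _; rewrite lee_fin powR_mulrn// normrX.
pose wL : L2 mD := Lfun_Sub (lee1n 2) w2.
have wE x : wL x = w x by [].
have adu : {ae m, forall x, a x <= u x <= b x} by have [] := sol.
have adw : admissible a b wL.
  by apply: filterS adu => x /andP[au ub]; rewrite wE; apply: clamp_bounds; exact: le_trans ub.
have VI := variational_inequality adw.
have I2 := L2_mulP (wL - u) (wL - u).
have I1 := L2_mulP (q + alpha *: u) (wL - u).
have pw : {ae m, forall x, (q x + alpha * u x) * (wL x - u x) <=
    - alpha * ((wL x - u x) * (wL x - u x))}.
  apply: filterS adu => x /andP[au ub]; rewrite wE /w /clamp.
  set v := - _; have -> : q x = - alpha * v by rewrite /v; field; rewrite gt_eqF.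
  have ab := le_trans au ub.
  (* The obtuse-angle property of the projection w of v onto [a, b], tested with u in [a, b]. It
     suffices because (q + alpha u)(w - u) = alpha (w - v)(w - u) - alpha (w - u)^2. *)
  suff : (Num.max (a x) (Num.min (b x) v) - v) *
         (Num.max (a x) (Num.min (b x) v) - u x) <= 0.
    by set c := Num.max _ _ => cle; have := mulr_ge0_le0 (ltW alpha0) cle; lra.
  case: (leP (b x) v) => h1; case: (leP (a x) _) => h2.
  - by rewrite mulr_le0_ge0// ?subr_le0 ?subr_ge0.
  - by move: ab; rewrite leNgt h2.
  - by rewrite subrr mul0r.
  - by rewrite mulr_ge0_le0// ?subr_le0 ?subr_ge0// ltW.
pose d x := wL x - u x.
pose k x := (- alpha) * (d x * d x) - (q x + alpha * u x) * d x.
have iI2 : m.-integrable setT (EFin \o (fun x => (- alpha) * (d x * d x))).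
  rewrite (_ : _ \o _ = (fun x => (- alpha)%:E * (d x * d x)%:E)%E)//.
  exact: integrableZl.
have mk : measurable_fun setT k.
  by apply/measurable_EFinP; exact: measurable_int (integrableB measurableT iI2 I1).
have k0 : 0 <= \int[m]_x k x.
  (* [k] is nonnegative only almost everywhere, so it is exchanged for its positive part, which is
     nonnegative at every point. *)
  rewrite [leRHS](_ : _ = \int[m]_x Num.max (k x) 0).
    by apply: Rintegral_ge0 => x _; rewrite le_max lexx orbT.
  congr fine; apply: ae_eq_integral => //.
  - exact/measurable_EFinP.
  - by apply/measurable_EFinP; exact: measurable_maxr.
  - by apply: filterS pw => x px _; rewrite /= max_l// /k subr_ge0.
have dd0 : (\int[m]_x `|(d x * d x)%:E| = 0)%E.
  have : \int[m]_x (d x * d x) = 0.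
    apply/eqP; rewrite eq_le Rintegral_ge0 ?andbT; last first.
      by move=> x _; rewrite -expr2 sqr_ge0.
    rewrite -(pmulr_rle0 _ alpha0).
    move: k0; rewrite /k RintegralB// RintegralZl// => k0.
    by have := VI; rewrite /d in k0 *; lra.
  move=> E; under eq_integral do rewrite gee0_abs ?lee_fin -?expr2 ?sqr_ge0//.
  rewrite -[LHS]fineK; first exact: (congr1 EFin E).
  exact: (integrable_fin_num measurableT I2).
have md : measurable_fun setT (fun x => (d x * d x)%:E) by exact: measurable_int I2.
have := (ae_eq_integral_abs m measurableT md).1 dd0.
apply: filterS => x /(_ I) [] /eqP; rewrite mulf_eq0 orbb subr_eq0 => /eqP <-.
exact: wE.
Qed.

End projection_formula.

(** * Gradient estimates *)

Section gradient_bounds.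
Context (R : realType) (n : nat) (D : set 'rV[R]_n) (mD : measurable D).
Implicit Types (u w : 'rV[R]_n -> R) (g : 'rV[R]_n -> 'rV[R]_n).
Local Notation mu := (lebesgue_rV R n).
Local Notation m := (lebesgue_on mD).

Lemma coord_le_euclidean_norm (v : 'rV[R]_n) i : `|v 0 i| <= euclidean_norm v.
Proof.
rewrite /euclidean_norm -sqrtr_sqr ler_wsqrtr// (bigD1 i)//= lerDl.
by apply: sumr_ge0 => j _; exact: sqr_ge0.
Qed.

Lemma euclidean_normZ (c : R) (v : 'rV[R]_n) :
  euclidean_norm (c *: v) = `|c| * euclidean_norm v.
Proof.
rewrite /euclidean_norm -sqrtr_sqr -sqrtrM ?sqr_ge0//; congr Num.sqrt.
by rewrite mulr_sumr; apply: eq_bigr => j _; rewrite mxE exprMn.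
Qed.

Lemma weak_gradientP u : weakly_differentiable D u ->
  is_weak_gradient D u (weak_gradient D u).
Proof. by move=> wu; exact: (xgetPex (cst 0) wu). Qed.

Lemma weak_gradient_norm_ae u (C : R) :
  (weak_gradient_norm mD +oo u <= C%:E)%E ->
  {ae m, forall x, euclidean_norm (weak_gradient D u x) <= C}.
Proof.
(* When the domain is null the norm carries no information, and the whole space serves as
   exceptional set. *)
rewrite /weak_gradient_norm unlock /Lnorm; case: ifPn => [_ /ess_supP|m0 _].
  apply: filterS => x /=; rewrite lee_fin; apply: le_trans; exact: ler_norm.
exists setT; split => //.
by apply/eqP; rewrite eq_le measure_ge0 andbT leNgt.
Qed.

Lemma bounded_gradient u (C : R) : measurable_fun setT u -> 0 <= C ->
  weakly_differentiable D u -> (weak_gradient_norm mD +oo u <= C%:E)%E ->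
  exists g, (forall i, bounded_weak_partial D i u (fun x => g x 0 i)) /\
    {ae m, forall x, euclidean_norm (g x) <= C}.
Proof.
move=> mu_ C0 /weak_gradientP ug /weak_gradient_norm_ae uC.
set G := weak_gradient D u in ug uC.
exists (fun x => \row_i (if `|G x 0 i| <= C then G x 0 i else 0)); split.
  move=> i; under eq_fun do rewrite mxE.
  apply: weak_gradient_bounded_partial => //.
  apply/(ae_lebesgue_on mD); apply: filterS uC => x; apply: le_trans.
  exact: coord_le_euclidean_norm.
apply: filterS uC => x GC; rewrite (_ : \row_i _ = G x)//.
apply/rowP => i; rewrite mxE ifT//.
exact: le_trans (coord_le_euclidean_norm _ _) GC.
Qed.

Lemma is_weak_gradient_ae u w g : measurable_fun setT u ->
  {ae m, forall x, u x = w x} -> measurable_fun setT w ->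
  is_weak_gradient D w g -> is_weak_gradient D u g.
Proof.
move=> mu_ /ae_lebesgue_on uw mw [lw mg lg wg]; split => //.
- move=> K cK KD; have mK := compact_measurable_rV cK.
  have /integrableP[_ wfin] := lw K cK KD.
  apply/integrableP; split.
    by apply/measurable_EFinP; exact: measurable_funS mu_.
  rewrite (ae_eq_integral (fun x => `|(w x)%:E|)%E)//.
  - by apply: measurableT_comp => //; apply/measurable_EFinP; exact: measurable_funS mu_.
  - by apply: measurableT_comp => //; apply/measurable_EFinP; exact: measurable_funS mw.
  - by apply: filterS uw => x + Kx => /(_ (KD _ Kx)) /= ->.
- move=> phi i tphi; have [_ mpphi] := measurable_partial i tphi.
  rewrite -wg//; congr fine; apply: ae_eq_integral => //.
  + apply/measurable_EFinP; apply: (measurable_funS measurableT) => //.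
    exact: measurable_funM.
  + apply/measurable_EFinP; apply: (measurable_funS measurableT) => //.
    exact: measurable_funM.
  + by apply: filterS uw => x + Dx => /(_ Dx) /= ->.
Qed.

Lemma measurable_euclidean_norm g :
  (forall i, measurable_fun setT (fun x => g x 0 i)) ->
  measurable_fun setT (fun x => euclidean_norm (g x)).
Proof.
move=> mg; apply: (measurableT_comp (continuous_measurable_fun (@sqrt_continuous R))).
by apply: measurable_sum => i; exact: measurable_funX.
Qed.

(** Almost everywhere |f|^p is at most A^p + B^p 1_E. In the application [E] is the inactive set,
    where the bound B is of order 1/alpha but the measure is small. *)
Lemma Lnorm_le_split (p A B X : R) (f : 'rV[R]_n -> R) (E : set 'rV[R]_n) :
  1 <= p -> 0 <= A -> 0 <= B -> 0 <= X -> measurable_fun setT f -> measurable E ->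
  {ae m, forall x, `|f x| <= A \/ E x /\ `|f x| <= B} ->
  ((A `^ p)%:E * m setT + (B `^ p)%:E * m E <= (X `^ p)%:E)%E ->
  ('N[m]_(p%:E)[EFin \o f] <= X%:E)%E.
Proof.
move=> p1 A0 B0 X0 mf mE fAB le.
have p0 : 0 < p by exact: lt_le_trans p1.
have pow_le (x y : R) : 0 <= x -> x <= y -> x `^ p <= y `^ p.
  by move=> x0 xy; rewrite ge0_ler_powR ?nnegrE ?(le_trans x0 xy)// ltW.
have mfp : measurable_fun setT (fun x => (`|f x| `^ p)%:E).
  apply/measurable_EFinP.
  apply: (measurableT_comp (measurable_powR p)).
  exact: (measurableT_comp (@normr_measurable _ _) mf).
have mE1 : measurable_fun setT (fun x => ((B `^ p) * \1_E x)%:E).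
  by apply/measurable_EFinP; apply: measurable_funM => //; exact: measurable_indic.
have le1 : (\int[m]_x (`|f x| `^ p)%:E <= (X `^ p)%:E)%E.
  apply: le_trans le.
  apply: (@le_trans _ _ (\int[m]_x ((A `^ p)%:E + (B `^ p * \1_E x)%:E))%E).
    apply: ae_ge0_le_integral => //.
    - by move=> x _; rewrite -EFinD lee_fin addr_ge0 ?mulr_ge0 ?powR_ge0// indicE.
    - exact: emeasurable_funD.
    apply: filterS fAB => x [fA _|[Ex fB] _]; rewrite -EFinD lee_fin.
      by rewrite (le_trans (pow_le _ _ _ fA))// lerDl mulr_ge0 ?powR_ge0// indicE.
    by rewrite indicE mem_set// mulr1 (le_trans (pow_le _ _ _ fB))// lerDr powR_ge0.
  rewrite ge0_integralD//; last 2 first.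
  - by move=> x _; rewrite lee_fin powR_ge0.
  - by move=> x _; rewrite lee_fin mulr_ge0 ?powR_ge0// indicE.
  rewrite integral_cst//; apply: leeD => //.
  under eq_integral do rewrite EFinM.
  rewrite ge0_integralZl//; last 2 first.
  - by apply/measurable_EFinP; exact: measurable_indic.
  - by rewrite lee_fin powR_ge0.
  by rewrite integral_indic// setIT.
rewrite unlock /Lnorm.
apply: (@le_trans _ _ (((X `^ p)%:E) `^ p^-1)%E).
  apply: gt0_ler_poweR => //; first by rewrite invr_ge0 ltW.
  - by rewrite in_itv/= leey andbT; apply: integral_ge0 => x _; rewrite lee_fin powR_ge0.
  - by rewrite in_itv/= leey andbT lee_fin powR_ge0.
by rewrite poweR_EFin -powRrM mulfV ?gt_eqF// powRr1.
Qed.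

End gradient_bounds.

(** * Estimate for the gradient of the solution *)

(** Unifies the two cases of the measure condition: a finite exponent gives K = |C|, made
    nonnegative for later use, and [kappa = +oo] gives K = 0 with [k] arbitrary. *)
Lemma measure_condition_le (R : realType) (n : nat) (D : set 'rV[R]_n)
    (a b : 'rV[R]_n -> R) (q : R -> 'rV[R]_n -> R) (kappa : \bar R) (k : R) :
  measure_condition D a b q kappa -> kappa = k%:E \/ kappa = +oo%E ->
  exists alphabar K, [/\ 0 < alphabar, 0 <= K & forall alpha, 0 < alpha < alphabar ->
    (lebesgue_rV R n [set x | D x /\ (alpha * a x < - q alpha x < alpha * b x)%R] <=
      (K * alpha `^ k)%:E)%E].
Proof.
move=> mc [] kE; rewrite kE /= in mc.
  have [_ [alphabar [C [a0 H]]]] := mc.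
  exists alphabar, `|C|; split => // alpha aa.
  apply: le_trans (H _ aa) _; rewrite lee_fin ler_wpM2r ?powR_ge0//.
  exact: ler_norm.
have [alphabar a0 H] := mc; exists alphabar, 0; split => // alpha aa.
by rewrite H// mul0r.
Qed.

Section gradient_of_solution.
Context (R : realType) (n : nat) (D : set 'rV[R]_n) (mD : measurable D) (oD : open D).
Context (n_gt0 : (0 < n)%N).
Local Notation mu := (lebesgue_rV R n).
Local Notation m := (lebesgue_on mD).

Lemma gradient_clamp (u a b q : 'rV[R]_n -> R) (A B C alpha : R) : 0 < alpha ->
  measurable_fun setT u -> measurable_fun setT a -> measurable_fun setT b ->
  measurable_fun setT q -> 0 <= A -> 0 <= B -> 0 <= C ->
  weakly_differentiable D a -> (weak_gradient_norm mD +oo a <= A%:E)%E ->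
  weakly_differentiable D b -> (weak_gradient_norm mD +oo b <= B%:E)%E ->
  weakly_differentiable D q -> (weak_gradient_norm mD +oo q <= C%:E)%E ->
  {ae m, forall x, u x = clamp (a x) (b x) (- (alpha^-1 * q x))} ->
  weakly_differentiable D u /\
  {ae m, forall x, euclidean_norm (weak_gradient D u x) <= A + B \/
     [set x | D x /\ alpha * a x < - q x < alpha * b x] x /\
     euclidean_norm (weak_gradient D u x) <= alpha^-1 * C}.
Proof.
move=> alpha0 mu_ ma mb mq A0 B0 C0 wa aA wb bB wq qC uE.
have [ga [Ha gaA]] := bounded_gradient ma A0 wa aA.
have [gb [Hb gbB]] := bounded_gradient mb B0 wb bB.
have [gq [Hq gqC]] := bounded_gradient mq C0 wq qC.
pose w x := clamp (a x) (b x) (- (alpha^-1 * q x)).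
pose gw i x := if Num.min (b x) (- (alpha^-1 * q x)) <= a x then ga x 0 i else
  if - (alpha^-1 * q x) < b x then - (alpha^-1 * gq x 0 i) else gb x 0 i.
have Hw i : bounded_weak_partial D i w (gw i).
  exact: bounded_weak_partial_clamp oD (Ha i) (Hb i) (Hq i).
have wg := is_weak_gradient_partials n_gt0 Hw.
have mw : measurable_fun setT w by have [] := Hw (Ordinal n_gt0).
have ug := is_weak_gradient_ae mu_ uE mw wg.
have wu : weakly_differentiable D u by eexists; exact: ug.
split => //.
have ug' := weak_gradientP wu.
(* Both are weak gradients of [u], one chosen and one computed, so they agree almost everywhere. *)
have guE : {ae m, forall x, weak_gradient D u x = \row_i gw i x}.
  have H i : {ae m, forall x, weak_gradient D u x 0 i = (\row_i gw i x) 0 i}.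
    by apply/ae_lebesgue_on; exact: weak_partial_unique ug' ug.
  have : {ae m, forall x, forall i, weak_gradient D u x 0 i = (\row_i gw i x) 0 i}.
    exact: filter_forall.
  by apply: filterS => x gx; apply/rowP.
have Dae : {ae m, forall x, D x}.
  by apply/ae_lebesgue_on; exact: aeW.
apply: filterS (filterI (filterI Dae guE) (filterI gaA (filterI gbB gqC))).
move=> x [[Dx ->] [gaA' [gbB' gqC']]].
rewrite /gw; set v := - _.
case: (leP (Num.min (b x) v) (a x)) => h1.
  by left; rewrite (_ : \row_i _ = ga x) ?(le_trans gaA') ?lerDl//; apply/rowP => i; rewrite mxE.
case: (ltP v (b x)) => h2; last first.
  by left; rewrite (_ : \row_i _ = gb x) ?(le_trans gbB') ?lerDr//; apply/rowP => i; rewrite mxE.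
right; split.
  split => //; move: h1; rewrite lt_min => /andP[_ h1].
  have vE : - q x = alpha * v by rewrite /v; field; rewrite gt_eqF.
  by rewrite vE !ltr_pM2l// h1.
rewrite (_ : \row_i _ = - alpha^-1 *: gq x); last first.
  by apply/rowP => i; rewrite !mxE mulNr.
by rewrite euclidean_normZ normrN gtr0_norm ?invr_gt0// ler_pM2l ?invr_gt0.
Qed.

End gradient_of_solution.

Theorem lemma19 (R : realType) (n : nat) (n_gt0 : (0 < n)%N)
    (Omega : set 'rV[R]_n) (mOmega : measurable Omega)
    (oOmega : open Omega) (bOmega : bounded_set Omega)
    (H : completeNormedModType R) (dot : {dot H for idfun})
    (dotH : induces_norm dot) (z : H)
    (Y : normedModType R)
    (T : {linear L2 mOmega -> H}) (B : {linear L2 mOmega -> Y})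
    (S : {linear Y -> H})
    (cT : L2_continuous T) (cB : L2_continuous B) (cS : continuous S)
    (TE : forall u, T u = S (B u))
    (Bstar : (Y -> R) -> L2 mOmega) (BstarE : is_L2_adjoint B Bstar)
    (a b : 'rV[R]_n -> R)
    (leab : {ae lebesgue_on mOmega, forall x, a x <= b x})
    (ubar : R -> L2 mOmega)
    (solP : forall alpha, 0 < alpha -> solves_P T z a b alpha (ubar alpha))
    (pbar : R -> Y -> R)
    (pbarE : forall alpha, pbar alpha = adjoint dot S (T (ubar alpha) - z))
    (kappa : \bar R)
    (measureP :
       measure_condition Omega a b (fun alpha => Bstar (pbar alpha)) kappa)
    (regularity : exists2 C : R, 0 < C & forall alpha, 0 < alpha ->
       weakly_differentiable Omega (Bstar (pbar alpha)) /\
       (weak_gradient_norm mOmega +oo (Bstar (pbar alpha)) <= C%:E)%E)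
    (Wa : W1infty mOmega a) (Wb : W1infty mOmega b)
    (Cab : \bar R)
    (CabE : Cab = (weak_gradient_norm mOmega +oo a +
                   weak_gradient_norm mOmega +oo b)%E) :
  forall p : R, 1 <= p ->
  forall k : R, 0 < k -> (kappa = k%:E \/ kappa = +oo%E) ->
  exists2 C : R, 0 < C & \forall alpha \near 0^'+,
    weakly_differentiable Omega (ubar alpha) /\
    (weak_gradient_norm mOmega p%:E (ubar alpha) <=
       C%:E * maxe Cab (alpha `^ (k / p - 1))%:E)%E.
Proof.
move=> p p1 k k0 kappaE.
have p0 : 0 < p by exact: lt_le_trans p1.
have [C0 C0_gt0 reg] := regularity.
have [alphabar [K [ab0 K0 mA]]] := measure_condition_le measureP kappaE.
have [La wa na] := Wa; have [Lb wb nb] := Wb.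
have ma : measurable_fun setT a := set_mem (sub_Lfun_mfun La).
have mb : measurable_fun setT b := set_mem (sub_Lfun_mfun Lb).
have finO : (lebesgue_rV R n Omega < +oo)%E by exact: bounded_fin.
have normE (u : 'rV[R]_n -> R) : (weak_gradient_norm mOmega +oo u < +oo)%E ->
    exists2 A, 0 <= A & weak_gradient_norm mOmega +oo u = A%:E.
  move=> nu; have n0 : (0 <= weak_gradient_norm mOmega +oo u)%E by exact: Lnorm_ge0.
  exists (fine (weak_gradient_norm mOmega +oo u)); first exact: fine_ge0.
  by rewrite fineK// ge0_fin_numE.
have [A A0 AE] := normE _ na; have [B0 B0_ge0 B0E] := normE _ nb.
pose V := fine (lebesgue_rV R n Omega).
have V0 : 0 <= V by exact: fine_ge0.
(* With M the larger of A + B0 and [beta], the p-th power of the norm is at most (A + B0)^p V + C0^p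
   K beta^p <= Q M^p. *)
pose Q := V + C0 `^ p * K.
have Q0 : 0 <= Q by rewrite addr_ge0// mulr_ge0// powR_ge0.
exists (Q `^ p^-1 + 1); first by rewrite ltr_wpDl// powR_ge0.
near=> alpha.
have al0 : 0 < alpha by [].
have albar : 0 < alpha < alphabar.
  by rewrite al0/=; near: alpha; exact: nbhs_right_lt.
set q := Bstar (pbar alpha).
have [wq qC] := reg alpha al0.
have mq : measurable_fun setT q by [].
have muu : measurable_fun setT (ubar alpha) by [].
have uE : {ae lebesgue_on mOmega, forall x,
    ubar alpha x = clamp (a x) (b x) (- (alpha^-1 * q x))}.
  have := projection_formula finO dotH cS TE BstarE La Lb al0 (solP alpha al0).
  by rewrite -pbarE.
have Ale : (weak_gradient_norm mOmega +oo a <= A%:E)%E by rewrite AE.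
have Ble : (weak_gradient_norm mOmega +oo b <= B0%:E)%E by rewrite B0E.
have [wu gu] := gradient_clamp oOmega n_gt0 al0 muu ma mb mq A0 B0_ge0 (ltW C0_gt0)
  wa Ale wb Ble wq qC uE.
split => //.
set E : set 'rV[R]_n := [set x | Omega x /\ _] in gu.
have mE : measurable E.
  rewrite (_ : E = Omega `&` ([set x | alpha * a x < - q x] `&`
      [set x | - q x < alpha * b x])); last first.
    by apply/seteqP; split => x /= [Ox]; [move=> /andP[]|move=> [h1 h2]; split => //; apply/andP].
  have mlt (f g : 'rV[R]_n -> R) : measurable_fun setT f -> measurable_fun setT g ->
      measurable [set x | f x < g x].
    move=> mf mg; rewrite (_ : [set x | _] =
      setT `&` (fun x => f x < g x) @^-1` [set true]); last by rewrite setTI.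
    exact: (measurable_fun_ltr mf mg).
  apply: measurableI => //; apply: measurableI; apply: mlt.
  - exact: measurable_funM.
  - exact: measurable_funN.
  - exact: measurable_funN.
  - exact: measurable_funM.
pose beta := alpha `^ (k / p - 1).
have beta0 : 0 <= beta by exact: powR_ge0.
pose M := Num.max (A + B0) beta.
have AM : A + B0 <= M by rewrite le_max lexx.
have bM : beta <= M by rewrite le_max lexx orbT.
have M0 : 0 <= M by exact: le_trans bM.
have pow_le (x y : R) : 0 <= x -> x <= y -> x `^ p <= y `^ p.
  by move=> x0 xy; rewrite ge0_ler_powR ?nnegrE ?(le_trans x0 xy)// ltW.
rewrite CabE AE B0E -EFinD -EFin_max -EFinM -/M.
apply: (@le_trans _ _ (Q `^ p^-1 * M)%:E); last first.
  by rewrite lee_fin ler_wpM2r// lerDl.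
have [_ mg _ _] := weak_gradientP wu.
apply: (@Lnorm_le_split _ _ _ _ p (A + B0) (alpha^-1 * C0) _ _ E) => //.
- exact: addr_ge0.
- by apply: mulr_ge0; [rewrite invr_ge0|]; exact: ltW.
- by rewrite mulr_ge0// powR_ge0.
- exact: measurable_euclidean_norm.
- have e0 x : `|euclidean_norm (weak_gradient Omega (ubar alpha) x)| =
      euclidean_norm (weak_gradient Omega (ubar alpha) x).
    by rewrite ger0_norm// sqrtr_ge0.
  by apply: filterS gu => x; rewrite e0.
have -> : lebesgue_on mOmega setT = V%:E.
  change (lebesgue_rV R n (setT `&` Omega) = V%:E).
  by rewrite setTI /V fineK// ge0_fin_numE.
have -> : lebesgue_on mOmega E = lebesgue_rV R n E.
  change (lebesgue_rV R n (E `&` Omega) = lebesgue_rV R n E).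
  by congr (lebesgue_rV R n _); apply/setIidl => x [].
(* The origin of the exponent k/p - 1: alpha^(- p) alpha^k is the p-th power of alpha^(k/p - 1). *)
have powE : (alpha^-1 * C0) `^ p * (K * alpha `^ k) = C0 `^ p * K * beta `^ p.
  have inv_pow : alpha^-1 `^ p = (alpha `^ p)^-1.
    by rewrite -(powR_inv1 (ltW al0)) -powRrM mulN1r powRN.
  have beta_pow : beta `^ p = alpha `^ k / alpha `^ p.
    rewrite /beta -powRrM mulrBl mulfVK ?gt_eqF// mul1r powRB//.
    by rewrite (gt_eqF al0) implybT.
  rewrite powRM ?invr_ge0 ?(ltW al0) ?(ltW C0_gt0)// inv_pow beta_pow.
  by ring.
apply: (@le_trans _ _ ((A + B0) `^ p * V + (alpha^-1 * C0) `^ p * (K * alpha `^ k))%:E).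
  rewrite EFinD !EFinM leeD// lee_wpmul2l ?lee_fin ?powR_ge0//.
  by rewrite -EFinM; exact: mA.
rewrite lee_fin powE powRM ?powR_ge0// -powRrM mulVf ?gt_eqF// powRr1// /Q mulrDl.
rewrite lerD//.
  by rewrite mulrC ler_wpM2l// pow_le// addr_ge0.
by rewrite ler_wpM2l ?mulr_ge0 ?powR_ge0// pow_le.
Unshelve. all: by end_near. Qed.
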